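(* Consider the following list of indecomposable four-dimensional real Lie superalgebras (brackets are given in a homogeneous basis, even basis vectors before the bar and odd ones after it; brackets not determined by the displayed ones through super anti-commutativity are zero; parameters are real). Superdimension $2|2$, basis $e_1,e_2\,|\,e_3,e_4$: - $D^5$: $[e_1,e_3]=e_3$, $[e_1,e_4]=e_4$, $[e_2,e_4]=e_3$. - $D^6$: $[e_1,e_3]=e_3$, $[e_1,e_4]=e_4$, $[e_2,e_3]=-e_4$, $[e_2,e_4]=e_3$. - $D^7_{pq}$ ($pq\neq 0$, $p\ge q$): $[e_1,e_2]=e_2$, $[e_1,e_3]=pe_3$, $[e_1,e_4]=qe_4$. - $D^8_p$ ($p\ne 0$): $[e_1,e_2]=e_2$, $[e_1,e_3]=pe_3$, $[e_1,e_4]=e_3+pe_4$. - $D^9_{pq}$ ($q>0$): $[e_1,e_2]=e_2$, $[e_1,e_3]=pe_3-qe_4$, $[e_1,e_4]=qe_3+pe_4$. - $D^{10}_q$: $[e_1,e_2]=e_2$, $[e_1,e_3]=(q+1)e_3$, $[e_1,e_4]=qe_4$, $[e_2,e_4]=e_3$. - $(D^7_{1/2\,1/2})^1$: $[e_1,e_2]=e_2$, $[e_1,e_3]=\frac12e_3$, $[e_1,e_4]=\frac12e_4$, $[e_3,e_3]=e_2$, $[e_4,e_4]=e_2$. - $(D^7_{1/2\,1/2})^2$: $[e_1,e_2]=e_2$, $[e_1,e_3]=\frac12e_3$, $[e_1,e_4]=\frac12e_4$, $[e_3,e_3]=e_2$, $[e_4,e_4]=-e_2$. - $(D^7_{1/2\,1/2})^3$: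 $[e_1,e_2]=e_2$, $[e_1,e_3]=\frac12e_3$, $[e_1,e_4]=\frac12e_4$, $[e_3,e_3]=e_2$. - $(D^7_{1-p,p})$ ($p\le\frac12$): $[e_1,e_2]=e_2$, $[e_1,e_3]=pe_3$, $[e_1,e_4]=(1-p)e_4$, $[e_3,e_4]=e_2$. - $(D^8_{1/2})$: $[e_1,e_2]=e_2$, $[e_1,e_3]=\frac12e_3$, $[e_1,e_4]=e_3+\frac12e_4$, $[e_4,e_4]=e_2$. - $(D^9_{1/2,p})$ ($p>0$): $[e_1,e_2]=e_2$, $[e_1,e_3]=\frac12e_3-pe_4$, $[e_1,e_4]=pe_3+\frac12e_4$, $[e_3,e_3]=e_2$, $[e_4,e_4]=e_2$. - $(D^{10}_0)^1$: $[e_1,e_2]=e_2$, $[e_1,e_3]=e_3$, $[e_2,e_4]=e_3$, $[e_4,e_4]=e_1$, $[e_3,e_4]=-\frac12e_2$. - $(D^{10}_0)^2$: $[e_1,e_2]=e_2$, $[e_1,e_3]=e_3$, $[e_2,e_4]=e_3$, $[e_4,e_4]=-e_1$, $[e_3,e_4]=\frac12e_2$. - $(2A_{1,1}+2A)^1$: $[e_3,e_3]=e_1$, $[e_4,e_4]=e_2$. - $(2A_{1,1}+2A)^2$: $[e_3,e_3]=e_1$, $[e_4,e_4]=e_2$, $[e_3,e_4]=e_1$. - $(2A_{1,1}+2A)^3_p$ ($p>0$): $[e_3,e_3]=e_1$, $[e_4,e_4]=e_2$, $[e_3,e_4]=p(e_1+e_2)$. - $(2A_{1,1}+2A)^4_p$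 ($p>0$): $[e_3,e_3]=e_1$, $[e_4,e_4]=e_2$, $[e_3,e_4]=p(e_1-e_2)$. - $(C^1_1+A)$: $[e_1,e_2]=e_2$, $[e_1,e_3]=e_3$, $[e_3,e_4]=e_2$. - $(C^1_{1/2}+A)$: $[e_1,e_2]=e_2$, $[e_1,e_3]=\frac12e_3$, $[e_3,e_3]=e_2$. - $(C^2_{-1}+A)$: $[e_1,e_3]=e_3$, $[e_1,e_4]=-e_4$, $[e_3,e_4]=e_2$. - $(C^3+A)$: $[e_1,e_4]=e_3$, $[e_4,e_4]=e_2$. - $(C^5_0+A)$: $[e_1,e_3]=-e_4$, $[e_1,e_4]=e_3$, $[e_3,e_3]=e_2$, $[e_4,e_4]=e_2$. Superdimension $3|1$, basis $e_1,e_2,e_3\,|\,e_4$: - $D^1$: $[e_2,e_3]=e_1$, $[e_2,e_4]=e_4$. - $D^2_q$ ($q\ne0$): $[e_1,e_3]=e_1$, $[e_2,e_3]=e_1+e_2$, $[e_3,e_4]=qe_4$. - $D^3_{pq}$ ($pq\neq0$): $[e_1,e_3]=pe_1-e_2$, $[e_2,e_3]=e_1+pe_2$, $[e_3,e_4]=qe_4$. - $(A_{3,1}+A)$: $[e_2,e_3]=e_1$, $[e_4,e_4]=e_1$. - $(D^3_{p,-1/2})$ ($p\neq0$): $[e_1,e_2]=e_2$, $[e_1,e_3]=pe_3$, $[e_1,e_4]=\frac12e_4$, $[e_4,e_4]=e_2$. - $(D^2_{-1/2})^1$: $[e_1,e_2]=e_2$, $[e_1,e_3]=e_2+e_3$,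 $[e_1,e_4]=\frac12e_4$, $[e_4,e_4]=e_2$. - $(D^2_{-1/2})^2$: $[e_1,e_2]=e_2$, $[e_1,e_3]=-e_2+e_3$, $[e_1,e_4]=\frac12e_4$, $[e_4,e_4]=e_2$. Superdimension $1|3$, basis $e_1\,|\,e_2,e_3,e_4$: - $D^{11}_{pq}$ ($0<|p|\le|q|\le1$): $[e_1,e_2]=e_2$, $[e_1,e_3]=pe_3$, $[e_1,e_4]=qe_4$. - $D^{12}$: $[e_1,e_2]=e_2$, $[e_1,e_4]=e_3$. - $D^{13}_p$ ($p\ne0$): $[e_1,e_2]=pe_2$, $[e_1,e_3]=e_3$, $[e_1,e_4]=e_3+e_4$. - $D^{14}_{pq}$ ($p\neq0$, $q\ge0$): $[e_1,e_2]=pe_2$, $[e_1,e_3]=qe_3-e_4$, $[e_1,e_4]=e_3+qe_4$. - $D^{15}$: $[e_1,e_3]=e_2$, $[e_1,e_4]=e_3$. - $D^{16}$: $[e_1,e_2]=e_2$, $[e_1,e_3]=e_2+e_3$, $[e_1,e_4]=e_3+e_4$. - $(A_{1,1}+3A)^1$: $[e_2,e_2]=e_1$, $[e_3,e_3]=e_1$, $[e_4,e_4]=e_1$. - $(A_{1,1}+3A)^2$: $[e_2,e_2]=e_1$, $[e_3,e_3]=e_1$, $[e_4,e_4]=-e_1$. Then: (i) every Lie superalgebra in the list admits a compatible left-symmetric superalgebra structure; (ii) every Lie superalgebra in the list other than $(D^{10}_0)^1$ and $(D^{10}_0)^2$ admits a compatible Novikov superalgebra structure, whereas neither $(D^{10}_0)^1$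 nor $(D^{10}_0)^2$ admits a compatible Novikov superalgebra structure; (iii) every Lie superalgebra in the list admits a compatible Balinsky--Novikov superalgebra structure.
   Context: The ground field is $\mathbb R$; $|x|\in\{\bar0,\bar1\}$ denotes the parity of a homogeneous element. Lie superalgebras satisfy $[x,y]=-(-1)^{|x||y|}[y,x]$ and $[x,[y,z]]=[[x,y],z]+(-1)^{|x||y|}[y,[x,z]]$. A left-symmetric superalgebra (LSSA) is a superspace $L=L_{\bar0}\oplus L_{\bar1}$ with an even bilinear product $\cdot$ whose associator $(x,y,z)=(x\cdot y)\cdot z-x\cdot(y\cdot z)$ satisfies $(x,y,z)=(-1)^{|x||y|}(y,x,z)$ for all homogeneous $x,y,z$. A Novikov superalgebra is an LSSA that also satisfies $(z\cdot x)\cdot y=(-1)^{|x||y|}(z\cdot y)\cdot x$ for all homogeneous $x,y$ and all $z$. An LSSA or Novikov structure on the underlying superspace of a Lie superalgebra $\mathfrak g$ is compatible if $[x,y]=x\cdot y-(-1)^{|x||y|}y\cdot x$ for all homogeneous $x,y\in\mathfrak g$. A Balinsky--Novikov (BN) superalgebra is a superspace $L=L_{\bar0}\oplus L_{\bar1}$ with an even bilinear product $\cdot$ such that: (1) $(x\cdot y)\cdot z-x\cdot(y\cdot z)=(y\cdot x)\cdot z-y\cdot(x\cdot z)$ and $(x\cdot y)\cdot z=(x\cdot z)\cdot y$ whenever $x,y,z$ are homogeneous and either all three are even, or exactly one of them is odd; (2) $x\cdot y=y\cdot x$ for all $x,y\in L_{\bar1}$; (3) $(x\cdot y)\cdot z=(x\cdot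 z)\cdot y$ for $x,y\in L_{\bar1}$, $z\in L_{\bar0}$; $x\cdot(y\cdot z)=(x\cdot y)\cdot z+y\cdot(x\cdot z)$ for $x\in L_{\bar0}$, $y,z\in L_{\bar1}$; $x\cdot(y\cdot z)=(x\cdot y)\cdot z+(x\cdot z)\cdot y$ for $x,y,z\in L_{\bar1}$. A BN structure on the underlying superspace of a Lie superalgebra $\mathfrak g$ is compatible if $[x,y]=x\cdot y-y\cdot x$ for $x,y\in\mathfrak g_{\bar0}$, $[x,y]=x\cdot y-\frac12y\cdot x=-[y,x]$ for $x\in\mathfrak g_{\bar0}$, $y\in\mathfrak g_{\bar1}$, and $[x,y]=x\cdot y$ for $x,y\in\mathfrak g_{\bar1}$. *)

(* Defs.v *)
From HB Require Import structures.
From mathcomp Require Import all_boot all_order all_algebra.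
From mathcomp Require Import ring.
From mathcomp Require Import reals.

Set Implicit Arguments.
Unset Strict Implicit.
Unset Printing Implicit Defensive.

Import Order.TTheory GRing.Theory Num.Theory.
Local Open Scope ring_scope.

(* Parities are booleans: false is even, true is odd, and addition of parities
   is the exclusive or (+). *)

Record superspace (R : realType) := Superspace {
  evenPart : lmodType R;
  oddPart : lmodType R
}.

Definition carrier (R : realType) (L : superspace R) : lmodType R :=
  (evenPart L * oddPart L)%type.
Coercion carrier : superspace >-> GRing.Lmodule.type.

Section Superalgebras.
Variables (R : realType) (L : superspace R).
Implicit Types (x y z : L) (a b c : bool).

(* The zero vector is homogeneous of both parities; every identity below is
   trivial when one of its homogeneous arguments is zero. *)
Definition homogeneous a x : Prop := if a then x.1 = 0 else x.2 = 0.

Definition koszul a b : R := (-1) ^+ (a && b).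

Variable mu : L -> L -> L.

Definition bilinear_product : Prop :=
  (forall x, linear (mu x)) /\ (forall y, linear (mu ^~ y)).

Definition even_product : Prop := forall a b x y,
  homogeneous a x -> homogeneous b y -> homogeneous (a (+) b) (mu x y).

Definition associator x y z : L := mu (mu x y) z - mu x (mu y z).

Definition is_LSSA : Prop :=
  [/\ bilinear_product, even_product &
    forall a b c x y z,
      homogeneous a x -> homogeneous b y -> homogeneous c z ->
      associator x y z = koszul a b *: associator y x z].

Definition is_Novikov : Prop :=
  is_LSSA /\
  forall a b x y z, homogeneous a x -> homogeneous b y ->
    mu (mu z x) y = koszul a b *: mu (mu z y) x.

Definition is_BN : Prop :=
  [/\ bilinear_product /\ even_product,
      (* at most one of x, y, z is odd *)
      forall a b c x y z, (a + b + c <= 1)%N ->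
        homogeneous a x -> homogeneous b y -> homogeneous c z ->
        mu (mu x y) z - mu x (mu y z) = mu (mu y x) z - mu y (mu x z) /\
        mu (mu x y) z = mu (mu x z) y,
      forall x y, homogeneous true x -> homogeneous true y -> mu x y = mu y x &
      [/\ forall x y z,
            homogeneous true x -> homogeneous true y -> homogeneous false z ->
            mu (mu x y) z = mu (mu x z) y,
          forall x y z,
            homogeneous false x -> homogeneous true y -> homogeneous true z ->
            mu x (mu y z) = mu (mu x y) z + mu y (mu x z) &
          forall x y z,
            homogeneous true x -> homogeneous true y -> homogeneous true z ->
            mu x (mu y z) = mu (mu x y) z + mu (mu x z) y]].

Definition is_Lie : Prop :=
  [/\ bilinear_product, even_product,
      forall a b x y, homogeneous a x -> homogeneous b y ->
        mu x y = - (koszul a b *: mu y x) &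
      forall a b c x y z,
        homogeneous a x -> homogeneous b y -> homogeneous c z ->
        mu x (mu y z) = mu (mu x y) z + koszul a b *: mu y (mu x z)].

End Superalgebras.

Record lieSuperalgebra (R : realType) := LieSuperalgebra {
  lieSpace :> superspace R;
  bracket : lieSpace -> lieSpace -> lieSpace;
  bracketP : is_Lie bracket
}.

Section Compatibility.
Variables (R : realType) (g : lieSuperalgebra R).

Definition compatible (mu : g -> g -> g) : Prop :=
  forall a b (x y : g), homogeneous a x -> homogeneous b y ->
    bracket x y = mu x y - koszul R a b *: mu y x.

Definition BN_compatible (mu : g -> g -> g) : Prop :=
  [/\ forall x y : g, homogeneous false x -> homogeneous false y ->
        bracket x y = mu x y - mu y x,
      forall x y : g, homogeneous false x -> homogeneous true y ->
        bracket x y = mu x y - 2^-1 *: mu y x /\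
        mu x y - 2^-1 *: mu y x = - bracket y x &
      forall x y : g, homogeneous true x -> homogeneous true y ->
        bracket x y = mu x y].

Definition admits_LSSA : Prop := exists mu : g -> g -> g,
  is_LSSA mu /\ compatible mu.

Definition admits_Novikov : Prop := exists mu : g -> g -> g,
  is_Novikov mu /\ compatible mu.

Definition admits_BN : Prop := exists mu : g -> g -> g,
  is_BN mu /\ BN_compatible mu.

End Compatibility.

(* [:: (c1, k1); ...; (cr, kr)] stands for c1 e_k1 + ... + cr e_kr. *)
Definition lincomb (R : realType) := seq (R * nat).

(* The superspace R^(m|n) with its homogeneous basis e_1, ..., e_m (even),
   e_(m+1), ..., e_(m+n) (odd); indices start at 1. *)
Section StandardSuperspace.
Variables (R : realType) (m n : nat).

Definition stdSpace : superspace R := Superspace 'rV[R]_m 'rV[R]_n.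

Definition stdBasis (k : nat) : stdSpace :=
  (\row_(i < m) (k == i.+1)%:R, \row_(j < n) (k == (m + j).+1)%:R).

Definition e_odd (k : nat) : bool := (m < k)%N.

Definition coord (x : stdSpace) (i : 'I_(m + n)) : R := row_mx x.1 x.2 0 i.

Definition combine (s : lincomb R) : stdSpace := \sum_(t <- s) t.1 *: stdBasis t.2.

(* D i j is the displayed value of [e_i, e_j], used only for i <= j; the
   brackets [e_i, e_j] with j < i follow by super anti-commutativity. *)
Variable D : nat -> nat -> lincomb R.

Definition basis_bracket (i j : nat) : stdSpace :=
  if (i <= j)%N then combine (D i j)
  else - (koszul R (e_odd i) (e_odd j) *: combine (D j i)).

Definition std_bracket (x y : stdSpace) : stdSpace :=
  \sum_(i < m + n) \sum_(j < m + n)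
    (coord x i * coord y j) *: basis_bracket i.+1 j.+1.

End StandardSuperspace.

(* A final _i marks the superscript outside the parentheses: D10_0_1 is
   (D^10_0)^1 and A11_3A_2 is (A_{1,1}+3A)^2; A11A11_2A is (2A_{1,1}+2A),
   D7_1subp_p is (D^7_{1-p,p}), and half, mhalf, m1 are the subscripts 1/2,
   -1/2, -1. *)
Inductive listed (R : realType) : Type :=
| D5
| D6
| D7 (p q : R) of p * q != 0 & q <= p
| D8 (p : R) of p != 0
| D9 (p q : R) of 0 < q
| D10 (q : R)
| D7_half_half_1
| D7_half_half_2
| D7_half_half_3
| D7_1subp_p (p : R) of p <= 2^-1
| D8_half
| D9_half (p : R) of 0 < p
| D10_0_1
| D10_0_2
| A11A11_2A_1
| A11A11_2A_2
| A11A11_2A_3 (p : R) of 0 < p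
| A11A11_2A_4 (p : R) of 0 < p
| C11_A
| C1half_A
| C2m1_A
| C3_A
| C50_A
| D1
| D2 (q : R) of q != 0
| D3 (p q : R) of p * q != 0
| A31_A
| D3_mhalf (p : R) of p != 0
| D2_mhalf_1
| D2_mhalf_2
| D11 (p q : R) of 0 < `|p| & `|p| <= `|q| & `|q| <= 1
| D12
| D13 (p : R) of p != 0
| D14 (p q : R) of p != 0 & 0 <= q
| D15
| D16
| A11_3A_1
| A11_3A_2.

Local Notation "c *e k" := (c%R, k%N) (at level 40).

Section Table.
Variable R : realType.

Definition evdim (g : listed R) : nat :=
  match g with
  | D1 | D2 _ _ | D3 _ _ _ | A31_A | D3_mhalf _ _ | D2_mhalf_1 | D2_mhalf_2 => 3
  | D11 _ _ _ _ _ | D12 | D13 _ _ | D14 _ _ _ _ | D15 | D16 | A11_3A_1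
  | A11_3A_2 => 1
  | _ => 2
  end%N.

Definition odddim (g : listed R) : nat := (4 - evdim g)%N.

Local Open Scope nat_scope.

Definition displayed (g : listed R) (i j : nat) : lincomb R :=
  match g with
  | D5 => match i, j with
      | 1, 3 => [:: 1 *e 3] | 1, 4 => [:: 1 *e 4] | 2, 4 => [:: 1 *e 3]
      | _, _ => [::] end
  | D6 => match i, j with
      | 1, 3 => [:: 1 *e 3] | 1, 4 => [:: 1 *e 4]
      | 2, 3 => [:: -1 *e 4] | 2, 4 => [:: 1 *e 3]
      | _, _ => [::] end
  | D7 p q _ _ => match i, j with
      | 1, 2 => [:: 1 *e 2] | 1, 3 => [:: p *e 3] | 1, 4 => [:: q *e 4]
      | _, _ => [::] end
  | D8 p _ => match i, j with
      | 1, 2 => [:: 1 *e 2] | 1, 3 => [:: p *e 3]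
      | 1, 4 => [:: 1 *e 3; p *e 4]
      | _, _ => [::] end
  | D9 p q _ => match i, j with
      | 1, 2 => [:: 1 *e 2] | 1, 3 => [:: p *e 3; - q *e 4]
      | 1, 4 => [:: q *e 3; p *e 4]
      | _, _ => [::] end
  | D10 q => match i, j with
      | 1, 2 => [:: 1 *e 2] | 1, 3 => [:: (q + 1) *e 3] | 1, 4 => [:: q *e 4]
      | 2, 4 => [:: 1 *e 3]
      | _, _ => [::] end
  | D7_half_half_1 => match i, j with
      | 1, 2 => [:: 1 *e 2] | 1, 3 => [:: 2^-1 *e 3] | 1, 4 => [:: 2^-1 *e 4]
      | 3, 3 => [:: 1 *e 2] | 4, 4 => [:: 1 *e 2]
      | _, _ => [::] end
  | D7_half_half_2 => match i, j with
      | 1, 2 => [:: 1 *e 2] | 1, 3 => [:: 2^-1 *e 3] | 1, 4 => [:: 2^-1 *e 4]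
      | 3, 3 => [:: 1 *e 2] | 4, 4 => [:: -1 *e 2]
      | _, _ => [::] end
  | D7_half_half_3 => match i, j with
      | 1, 2 => [:: 1 *e 2] | 1, 3 => [:: 2^-1 *e 3] | 1, 4 => [:: 2^-1 *e 4]
      | 3, 3 => [:: 1 *e 2]
      | _, _ => [::] end
  | D7_1subp_p p _ => match i, j with
      | 1, 2 => [:: 1 *e 2] | 1, 3 => [:: p *e 3] | 1, 4 => [:: (1 - p) *e 4]
      | 3, 4 => [:: 1 *e 2]
      | _, _ => [::] end
  | D8_half => match i, j with
      | 1, 2 => [:: 1 *e 2] | 1, 3 => [:: 2^-1 *e 3]
      | 1, 4 => [:: 1 *e 3; 2^-1 *e 4] | 4, 4 => [:: 1 *e 2]
      | _, _ => [::] end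
  | D9_half p _ => match i, j with
      | 1, 2 => [:: 1 *e 2] | 1, 3 => [:: 2^-1 *e 3; - p *e 4]
      | 1, 4 => [:: p *e 3; 2^-1 *e 4]
      | 3, 3 => [:: 1 *e 2] | 4, 4 => [:: 1 *e 2]
      | _, _ => [::] end
  | D10_0_1 => match i, j with
      | 1, 2 => [:: 1 *e 2] | 1, 3 => [:: 1 *e 3] | 2, 4 => [:: 1 *e 3]
      | 4, 4 => [:: 1 *e 1] | 3, 4 => [:: - 2^-1 *e 2]
      | _, _ => [::] end
  | D10_0_2 => match i, j with
      | 1, 2 => [:: 1 *e 2] | 1, 3 => [:: 1 *e 3] | 2, 4 => [:: 1 *e 3]
      | 4, 4 => [:: -1 *e 1] | 3, 4 => [:: 2^-1 *e 2]
      | _, _ => [::] end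
  | A11A11_2A_1 => match i, j with
      | 3, 3 => [:: 1 *e 1] | 4, 4 => [:: 1 *e 2]
      | _, _ => [::] end
  | A11A11_2A_2 => match i, j with
      | 3, 3 => [:: 1 *e 1] | 4, 4 => [:: 1 *e 2] | 3, 4 => [:: 1 *e 1]
      | _, _ => [::] end
  | A11A11_2A_3 p _ => match i, j with
      | 3, 3 => [:: 1 *e 1] | 4, 4 => [:: 1 *e 2]
      | 3, 4 => [:: p *e 1; p *e 2]
      | _, _ => [::] end
  | A11A11_2A_4 p _ => match i, j with
      | 3, 3 => [:: 1 *e 1] | 4, 4 => [:: 1 *e 2]
      | 3, 4 => [:: p *e 1; - p *e 2]
      | _, _ => [::] end
  | C11_A => match i, j with
      | 1, 2 => [:: 1 *e 2] | 1, 3 => [:: 1 *e 3] | 3, 4 => [:: 1 *e 2]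
      | _, _ => [::] end
  | C1half_A => match i, j with
      | 1, 2 => [:: 1 *e 2] | 1, 3 => [:: 2^-1 *e 3] | 3, 3 => [:: 1 *e 2]
      | _, _ => [::] end
  | C2m1_A => match i, j with
      | 1, 3 => [:: 1 *e 3] | 1, 4 => [:: -1 *e 4] | 3, 4 => [:: 1 *e 2]
      | _, _ => [::] end
  | C3_A => match i, j with
      | 1, 4 => [:: 1 *e 3] | 4, 4 => [:: 1 *e 2]
      | _, _ => [::] end
  | C50_A => match i, j with
      | 1, 3 => [:: -1 *e 4] | 1, 4 => [:: 1 *e 3]
      | 3, 3 => [:: 1 *e 2] | 4, 4 => [:: 1 *e 2]
      | _, _ => [::] end
  | D1 => match i, j with
      | 2, 3 => [:: 1 *e 1] | 2, 4 => [:: 1 *e 4]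
      | _, _ => [::] end
  | D2 q _ => match i, j with
      | 1, 3 => [:: 1 *e 1] | 2, 3 => [:: 1 *e 1; 1 *e 2] | 3, 4 => [:: q *e 4]
      | _, _ => [::] end
  | D3 p q _ => match i, j with
      | 1, 3 => [:: p *e 1; -1 *e 2] | 2, 3 => [:: 1 *e 1; p *e 2]
      | 3, 4 => [:: q *e 4]
      | _, _ => [::] end
  | A31_A => match i, j with
      | 2, 3 => [:: 1 *e 1] | 4, 4 => [:: 1 *e 1]
      | _, _ => [::] end
  | D3_mhalf p _ => match i, j with
      | 1, 2 => [:: 1 *e 2] | 1, 3 => [:: p *e 3] | 1, 4 => [:: 2^-1 *e 4]
      | 4, 4 => [:: 1 *e 2]
      | _, _ => [::] end
  | D2_mhalf_1 => match i, j with
      | 1, 2 => [:: 1 *e 2] | 1, 3 => [:: 1 *e 2; 1 *e 3]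
      | 1, 4 => [:: 2^-1 *e 4] | 4, 4 => [:: 1 *e 2]
      | _, _ => [::] end
  | D2_mhalf_2 => match i, j with
      | 1, 2 => [:: 1 *e 2] | 1, 3 => [:: -1 *e 2; 1 *e 3]
      | 1, 4 => [:: 2^-1 *e 4] | 4, 4 => [:: 1 *e 2]
      | _, _ => [::] end
  | D11 p q _ _ _ => match i, j with
      | 1, 2 => [:: 1 *e 2] | 1, 3 => [:: p *e 3] | 1, 4 => [:: q *e 4]
      | _, _ => [::] end
  | D12 => match i, j with
      | 1, 2 => [:: 1 *e 2] | 1, 4 => [:: 1 *e 3]
      | _, _ => [::] end
  | D13 p _ => match i, j with
      | 1, 2 => [:: p *e 2] | 1, 3 => [:: 1 *e 3] | 1, 4 => [:: 1 *e 3; 1 *e 4]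
      | _, _ => [::] end
  | D14 p q _ _ => match i, j with
      | 1, 2 => [:: p *e 2] | 1, 3 => [:: q *e 3; -1 *e 4]
      | 1, 4 => [:: 1 *e 3; q *e 4]
      | _, _ => [::] end
  | D15 => match i, j with
      | 1, 3 => [:: 1 *e 2] | 1, 4 => [:: 1 *e 3]
      | _, _ => [::] end
  | D16 => match i, j with
      | 1, 2 => [:: 1 *e 2] | 1, 3 => [:: 1 *e 2; 1 *e 3]
      | 1, 4 => [:: 1 *e 3; 1 *e 4]
      | _, _ => [::] end
  | A11_3A_1 => match i, j with
      | 2, 2 => [:: 1 *e 1] | 3, 3 => [:: 1 *e 1] | 4, 4 => [:: 1 *e 1]
      | _, _ => [::] end
  | A11_3A_2 => match i, j with
      | 2, 2 => [:: 1 *e 1] | 3, 3 => [:: 1 *e 1] | 4, 4 => [:: -1 *e 1]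
      | _, _ => [::] end
  end.

End Table.

Definition listed_space (R : realType) (g : listed R) : superspace R :=
  stdSpace R (evdim g) (odddim g).

Definition listed_bracket (R : realType) (g : listed R) :
    listed_space g -> listed_space g -> listed_space g :=
  std_bracket (displayed g).

(* Verification that the listed brackets satisfy the Lie axioms, by reduction to
   finitely many scalar identities between structure constants. *)
Section LieCheck.
Variables (R : realType) (m n : nat) (D : nat -> nat -> lincomb R).
Local Notation V := (stdSpace R m n).
Local Notation e := (stdBasis R m n).
Local Notation par := (e_odd m).
Local Notation combine := (@combine R m n).
Local Notation br := (@std_bracket R m n D).
Implicit Types (x y z : V).

Lemma coordP i (c : R) x y :
  @coord R m n (c *: x + y) i = c * coord x i + coord y i.
Proof. by rewrite /coord !mxE; case: split => j; rewrite !mxE. Qed.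

Lemma coord_e k i : coord (e k) i = (k == i.+1)%:R :> R.
Proof. by rewrite /coord mxE; case: splitP => j ->; rewrite mxE. Qed.

Lemma coord_inj x y : (forall i, coord x i = coord y i) -> x = y.
Proof.
case: x y => [x1 x2] [y1 y2] H.
suff /eq_row_mx[-> ->] : row_mx x1 x2 = row_mx y1 y2 by [].
by apply/rowP => i; exact: H.
Qed.

Lemma br_bilinear : bilinear_product br.
Proof.
split=> [x|y] c u v; rewrite /std_bracket scaler_sumr -big_split /=;
  apply: eq_bigr => i _; rewrite scaler_sumr -big_split /=;
  apply: eq_bigr => j _; rewrite coordP scalerA -scalerDl; congr (_ *: _); ring.
Qed.

Let brL y : {linear V -> V} := HB.pack (br ^~ y)
  (GRing.isLinear.Build R V V *:%R (br ^~ y) (br_bilinear.2 y)).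
Let brR x : {linear V -> V} := HB.pack (br x)
  (GRing.isLinear.Build R V V *:%R (br x) (br_bilinear.1 x)).

Lemma br_sumr (I : Type) (s : seq I) (c : I -> R) (v : I -> V) x :
  br x (\sum_(t <- s) c t *: v t) = \sum_(t <- s) c t *: br x (v t).
Proof.
rewrite -[LHS]/(brR x _) linear_sum; apply: eq_bigr => t _.
by rewrite linearZ.
Qed.

Lemma br_suml (I : Type) (s : seq I) (c : I -> R) (v : I -> V) x :
  br (\sum_(t <- s) c t *: v t) x = \sum_(t <- s) c t *: br (v t) x.
Proof.
rewrite -[LHS]/(brL x _) linear_sum; apply: eq_bigr => t _.
by rewrite linearZ.
Qed.

Lemma br_e i j : (0 < i <= m + n)%N -> (0 < j <= m + n)%N ->
  br (e i) (e j) = basis_bracket m n D i j.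
Proof.
case: i j => [//|i] [//|j] /= Hi Hj.
rewrite /std_bracket (bigD1 (Ordinal Hi)) //= (bigD1 (Ordinal Hj)) //=.
rewrite !coord_e !eqxx mulr1 scale1r !big1 ?addr0 // => [k Hk|k Hk].
  rewrite big1 // => l _; rewrite !coord_e eqSS.
  case: (i =P k) => [E|_]; last by rewrite mul0r scale0r.
  by move: Hk; rewrite -val_eqE /= E eqxx.
rewrite !coord_e eqSS.
case: (j =P k) => [E|_]; last by rewrite mulr0 scale0r.
by move: Hk; rewrite -val_eqE /= E eqxx.
Qed.

Lemma homogeneous_ind a (P : V -> Prop) :
  P 0 -> (forall c x y, P x -> P y -> P (c *: x + y)) ->
  (forall k, (0 < k <= m + n)%N -> par k = a -> P (e k)) ->
  forall x, homogeneous a x -> P x.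
Proof.
move=> P0 PD Pe x Hx.
have -> : x = \sum_(i < m + n) coord x i *: e i.+1.
  apply: coord_inj => i.
  have sumE (s : seq 'I_(m + n)) :
      coord (\sum_(j <- s) coord x j *: e j.+1) i =
      \sum_(j <- s) coord x j * (j == i)%:R.
    elim: s => [|j s IH]; first by rewrite !big_nil /coord row_mx0 mxE.
    by rewrite !big_cons coordP IH coord_e eqSS.
  rewrite sumE (bigD1 i) //= eqxx mulr1 big1 ?addr0 // => j /negPf ->.
  by rewrite mulr0.
elim: (index_enum _) => [|i s IH]; first by rewrite big_nil.
rewrite big_cons; case: (par i.+1 =P a) => [Hi|Hi].
  exact: PD (Pe i.+1 (ltn_ord i) Hi) IH.
suff -> : coord x i = 0 by rewrite scale0r add0r.
rewrite /coord mxE; move: Hi; rewrite /e_odd ltnS.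
case: splitP => j ->; rewrite ?leq_addr ?(leqNgt m j) ?ltn_ord;
  by case: a Hx {Pe} => //= -> _; rewrite mxE.
Qed.

Lemma e_homogeneous k : homogeneous (par k) (e k).
Proof.
rewrite /homogeneous /e_odd; case: ltnP => Hk /=; apply/rowP => i; rewrite !mxE.
  by case: eqP => // E; move: Hk; rewrite E ltnNge ltn_ord.
by case: eqP => // E; move: Hk; rewrite E ltnNge leq_addr.
Qed.

Lemma homogeneousP a c x y :
  homogeneous a x -> homogeneous a y -> homogeneous a (c *: x + y : V).
Proof. by case: a => /= -> ->; rewrite scaler0 addr0. Qed.

Lemma homogeneous0 a : homogeneous a (0 : V). Proof. by case: a. Qed.

Definition dterms i j : lincomb R :=
  if (i <= j)%N then D i j
  else [seq (- ((-1) ^+ (par i && par j) * t.1), t.2) | t <- D j i].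

Lemma eval_cat s t : combine (s ++ t) = combine s + combine t.
Proof. exact: big_cat. Qed.

Lemma eval_scale c s : combine [seq (c * t.1, t.2) | t <- s] = c *: combine s.
Proof.
rewrite /Defs.combine big_map scaler_sumr; apply: eq_bigr => t _.
by rewrite scalerA.
Qed.

Lemma evalE i j : basis_bracket m n D i j = combine (dterms i j).
Proof.
rewrite /basis_bracket /dterms; case: ifP => // _.
rewrite -scaleNr -eval_scale; congr combine; apply: eq_map => t.
by rewrite mulNr.
Qed.

Definition coefs (s : lincomb R) (k : nat) : seq R :=
  [seq t.1 | t <- s & t.2 == k].

Lemma eval0 s : (forall k, (0 < k <= m + n)%N -> \sum_(c <- coefs s k) c = 0) ->
  combine s = 0.
Proof.
move=> H; apply: coord_inj => i; have /H {H} : (0 < i.+1 <= m + n)%N := ltn_ord i.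
have -> : coord (0 : V) i = 0 by rewrite /coord row_mx0 mxE.
move=> <-; elim: s => [|t s IH].
  by rewrite /Defs.combine !big_nil /coord row_mx0 mxE.
rewrite /Defs.combine big_cons coordP -/(combine s) IH coord_e /coefs /=.
by case: eqP => _; rewrite ?mulr1 ?big_cons // mulr0 add0r.
Qed.

Definition jacobi_terms i j k : lincomb R :=
  flatten [seq [seq (t.1 * u.1, u.2) | u <- dterms i t.2] | t <- dterms j k] ++
  flatten [seq [seq (- t.1 * u.1, u.2) | u <- dterms t.2 k] | t <- dterms i j] ++
  flatten [seq [seq (- ((-1) ^+ (par i && par j) * t.1) * u.1, u.2)
                | u <- dterms j t.2] | t <- dterms i k].

Definition basis_range := iota 1 (m + n).

Definition terms_ok : bool :=
  all (fun i => all (fun j => all (fun t : R * nat =>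
    (0 < t.2 <= m + n)%N && (par t.2 == par i (+) par j)) (dterms i j)) basis_range)
  basis_range.

Definition diag_ok : bool :=
  all (fun i => par i || (size (D i i) == 0%N)) basis_range.

Definition jacobi_eqs : seq (seq R) :=
  [seq s <- flatten [seq flatten [seq flatten [seq
     [seq coefs (jacobi_terms i j k) l | l <- basis_range]
     | k <- basis_range] | j <- basis_range] | i <- basis_range] | size s != 0%N].

Fixpoint all_zero (s : seq (seq R)) : Prop :=
  if s is c :: s' then foldr +%R 0 c = 0 /\ all_zero s' else True.

Lemma mem_range k : (k \in basis_range) = (0 < k <= m + n)%N.
Proof. by rewrite mem_iota add1n ltnS. Qed.

Lemma all_zeroP s c : all_zero s -> c \in s -> \sum_(x <- c) x = 0.
Proof.
elim: s => //= d s IH [Hd Hs]; rewrite inE => /predU1P[->|]; last exact: IH.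
apply: etrans Hd.
by elim: d => [|x t IHt]; rewrite ?big_nil ?big_cons //= IHt.
Qed.

Lemma Lie_check : terms_ok -> diag_ok -> all_zero jacobi_eqs -> is_Lie br.
Proof.
move=> Hterms Hdiag Hjac.
have lin0 (f : {linear V -> V}) : f 0 = 0 by exact: raddf0.
have linP (f : {linear V -> V}) c x y : f (c *: x + y) = c *: f x + f y.
  by exact: linearP.
have br0x x : br 0 x = 0 by exact: (lin0 (brL x)).
have brx0 x : br x 0 = 0 by exact: (lin0 (brR x)).
have brP1 c x y z : br (c *: x + y) z = c *: br x z + br y z.
  exact: (linP (brL z)).
have brP2 c x y z : br z (c *: x + y) = c *: br z x + br z y.
  exact: (linP (brR z)).
have tok i j t : i \in basis_range -> j \in basis_range -> t \in dterms i j ->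
    (t.2 \in basis_range) && (par t.2 == par i (+) par j).
  move=> Hi Hj Ht; rewrite mem_range.
  by move: Hterms => /allP/(_ _ Hi)/allP/(_ _ Hj)/allP/(_ _ Ht).
have beE i j : i \in basis_range -> j \in basis_range -> br (e i) (e j) = combine (dterms i j).
  by rewrite !mem_range => Hi Hj; rewrite br_e // evalE.
split; first exact: br_bilinear.
- move=> a b x y Hx Hy.
  move: x Hx; apply: homogeneous_ind => [|c x1 x2 H1 H2|i Hi <-].
  + by rewrite br0x; exact: homogeneous0.
  + by rewrite brP1; exact: homogeneousP.
  move: y Hy; apply: homogeneous_ind => [|c x1 x2 H1 H2|j Hj <-].
  + by rewrite brx0; exact: homogeneous0.
  + by rewrite brP2; exact: homogeneousP.
  rewrite -mem_range in Hi; rewrite -mem_range in Hj.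
  rewrite beE //; have := tok i j ^~ Hi => /(_ _ Hj).
  elim: (dterms i j) => [|t s IH] Hs.
    by rewrite /Defs.combine big_nil; exact: homogeneous0.
  rewrite /Defs.combine big_cons; apply: homogeneousP; last first.
    by apply: IH => u Hu; apply: Hs; rewrite inE Hu orbT.
  by have /andP[_ /eqP<-] := Hs t (mem_head _ _); exact: e_homogeneous.
- move=> a b x y Hx Hy.
  move: x Hx; apply: homogeneous_ind => [|c x1 x2 H1 H2|i Hi <-].
  + by rewrite br0x brx0 scaler0 oppr0.
  + by rewrite brP1 brP2 H1 H2 scalerDr opprD !scalerN !scalerA mulrC.
  move: y Hy; apply: homogeneous_ind => [|c x1 x2 H1 H2|j Hj <-].
  + by rewrite br0x brx0 scaler0 oppr0.
  + by rewrite brP1 brP2 H1 H2 scalerDr opprD !scalerN !scalerA mulrC.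
  rewrite !br_e // /basis_bracket; case: (ltngtP i j) => [lij|lji|<-].
  + rewrite scalerN opprK scalerA /koszul andbC -expr2 sqrr_sign scale1r //.
  + by [].
  + move/allP: Hdiag => /(_ i); rewrite mem_range => /(_ Hi) /orP[->|/nilP ->].
      by rewrite /koszul /= expr1 scaleN1r opprK.
    by rewrite /Defs.combine big_nil scaler0 oppr0.
- move=> a b c x y z Hx Hy Hz.
  move: x Hx; apply: homogeneous_ind => [|d x1 x2 H1 H2|i Hi <-].
  + by rewrite !br0x brx0 scaler0 addr0.
  + rewrite !(brP1, brP2) H1 H2 !scalerDr !scalerA (mulrC d) -!addrA.
    by congr (_ + _); rewrite addrCA.
  move: y Hy; apply: homogeneous_ind => [|d x1 x2 H1 H2|j Hj <-].
  + by rewrite !(br0x,brx0) scaler0 addr0.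
  + rewrite !(brP1, brP2) H1 H2 !scalerDr !scalerA (mulrC d) -!addrA.
    by congr (_ + _); rewrite addrCA.
  move: z Hz; apply: homogeneous_ind => [|d x1 x2 H1 H2|k Hk _].
  + by rewrite !(br0x,brx0) scaler0 addr0.
  + rewrite !(brP1, brP2) H1 H2 !scalerDr !scalerA (mulrC d) -!addrA.
    by congr (_ + _); rewrite addrCA.
  rewrite -!mem_range in Hi Hj Hk.
  rewrite !beE // {1 3}/Defs.combine !br_sumr br_suml.
  have -> : \sum_(t <- dterms j k) t.1 *: br (e i) (e t.2) =
      \sum_(t <- dterms j k) t.1 *: combine (dterms i t.2).
    by apply: eq_big_seq => t /(tok _ _ _ Hj Hk)/andP[Ht _]; rewrite beE.
  have -> : \sum_(t <- dterms i j) t.1 *: br (e t.2) (e k) =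
      \sum_(t <- dterms i j) t.1 *: combine (dterms t.2 k).
    by apply: eq_big_seq => t /(tok _ _ _ Hi Hj)/andP[Ht _]; rewrite beE.
  have -> : \sum_(t <- dterms i k) t.1 *: br (e j) (e t.2) =
      \sum_(t <- dterms i k) t.1 *: combine (dterms j t.2).
    by apply: eq_big_seq => t /(tok _ _ _ Hi Hk)/andP[Ht _]; rewrite beE.
  have flatE (f : R -> R) (g : nat -> lincomb R) (s : lincomb R) :
      combine (flatten [seq [seq (f t.1 * u.1, u.2) | u <- g t.2] | t <- s]) =
      \sum_(t <- s) f t.1 *: combine (g t.2).
    elim: s => [|t s IH]; first by rewrite big_nil /Defs.combine big_nil.
    by rewrite /= eval_cat big_cons IH eval_scale.
  have := @eval0 (jacobi_terms i j k).
  rewrite /jacobi_terms !eval_cat.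
  rewrite (flatE id (dterms i)) (flatE -%R (dterms^~ k)).
  rewrite (flatE (fun r => - ((-1) ^+ (par i && par j) * r)) (dterms j)) => J0.
  apply/eqP; rewrite -subr_eq0; apply/eqP.
  rewrite -[RHS]J0.
    rewrite opprD scaler_sumr -!sumrN; congr (_ + (_ + _)).
    + by apply: eq_bigr => t _; rewrite scaleNr.
    + by apply: eq_bigr => t _; rewrite scaleNr scalerA.
  move=> l; rewrite -mem_range => Hl.
  have [/nilP ->|Hs] := boolP (size (coefs (jacobi_terms i j k) l) == 0%N).
    by rewrite big_nil.
  apply: (all_zeroP Hjac); rewrite mem_filter Hs /=.
  apply/flatten_mapP; exists i => //; apply/flatten_mapP; exists j => //.
  by apply/flatten_mapP; exists k => //; apply/mapP; exists l.
Qed.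

End LieCheck.

Lemma listed_bracketP (R : realType) (g : listed R) :
  is_Lie (listed_bracket (g := g)).
Proof.
case: g => *; apply: Lie_check;
  try by lazymatch goal with |- is_true _ => vm_compute end.
all: cbv beta iota zeta delta [
  jacobi_eqs jacobi_terms dterms coefs basis_range all_zero displayed evdim odddim
  e_odd flatten foldr map filter cat iota size fst snd leq eq_op eqn subn
  Nat.sub addn Nat.add andb negb nat_of_bool
  hasDecEq.eq_op Equality.eqtype_hasDecEq_mixin Equality.class
  Datatypes_nat__canonical__eqtype_Equality ssrnat.HB_unnamed_factory_1
  pred_of_simpl preim pred1 SimplPred].
all: repeat (apply: conj).
all: first [exact: I | ring | field].
all: exact: isT.
Qed.

Definition listed_Lie (R : realType) (g : listed R) : lieSuperalgebra R :=
  LieSuperalgebra (@listed_bracketP R g).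

(* Main.v *)
From HB Require Import structures.
Require Import Defs.
From mathcomp Require Import all_boot all_order all_algebra.
From mathcomp Require Import ring.
From mathcomp Require Import reals.

Set Implicit Arguments.
Unset Strict Implicit.
Unset Printing Implicit Defensive.

Import Order.TTheory GRing.Theory Num.Theory.
Local Open Scope ring_scope.

(** The existence claims rest on two families of explicit products.

    Most algebras of the list have an even element a and an ideal H of
    codimension one, complementary to a, such that [H,H] is central in H,
    D = [a,.] acts on [H,H] by a scalar c, and the even part of H is abelian
    (line_extension). Set x.y = [x,y]/2 on H, let a act on the left by D + l and
    every element be multiplied by a on the right with the scalar l. This is
    compatible and left-symmetric for every l, because D is a derivation and
    triple brackets in H vanish; right supercommutativity of (a.x).y amounts to
    c + 2l = 0, so l = -c/2 gives a Novikov structure (line_novikov). The same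
    recipe with other constants, forced by the coefficient 1/2 in the
    compatibility of even and odd elements, gives a Balinsky-Novikov structure
    with l = -2c/3 (line_BN).

    The others are semidirect products of a subalgebra B, in which even elements
    are central, by an abelian ideal K (semidirect_extension). Here
    x.y = [x,y]/2 on B, b.k = [b,k] and k.anything = 0 is left-symmetric: B has
    nilpotency class two, so its left multiplications on itself compose to zero,
    and on K they form the adjoint representation (semidirect_LSSA). It is
    Novikov as soon as [B,B] kills K (semidirect_novikov). A variant, doubled on
    the product of an odd b by an even k, is Balinsky-Novikov when the odd part
    of B acts on K by commuting operators (semidirect_BN).

    All the identities are multilinear, so they are checked on generators of the
    decomposition, where each becomes a linear identity between a few brackets.
    For the algebras of the list the decompositions are read off from the
    positions of the nonzero structure constants.

    For the two exceptional algebras, with [e4,e4] = s e1 and s nonzero, right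
    supercommutativity makes the square of right multiplication by e4 vanish;
    since e4.e4 = (s/2) e1, this kills e1.e4 and e4.e1. Evaluating the square of
    left multiplication by e4 at e2 and e3 in two ways then determines e2.e4 and
    e3.e4 up to two cases, both contradictory (no_novikov). *)

(** * Linear identities in modules *)

Section LinearExpressions.
Variables (R : realType) (V : lmodType R).

(** Formal linear combinations of the entries of an environment, for deciding
    equality in a module by comparing coefficients. *)
Inductive linexpr : Type :=
| LAtom of nat
| LZero
| LAdd of linexpr & linexpr
| LOpp of linexpr
| LScale of R & linexpr.

Fixpoint leval (env : seq V) (e : linexpr) : V :=
  match e with
  | LAtom i => nth 0 env i
  | LZero => 0
  | LAdd e1 e2 => leval env e1 + leval env e2
  | LOpp e1 => - leval env e1
  | LScale c e1 => c *: leval env e1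
  end.

Fixpoint lcoef (e : linexpr) (i : nat) : R :=
  match e with
  | LAtom j => if eqn j i then 1 else 0
  | LZero => 0
  | LAdd e1 e2 => lcoef e1 i + lcoef e2 i
  | LOpp e1 => - lcoef e1 i
  | LScale c e1 => c * lcoef e1 i
  end.

Fixpoint lcoef_eq (e1 e2 : linexpr) (n : nat) : Prop :=
  if n is n'.+1 then lcoef e1 n' = lcoef e2 n' /\ lcoef_eq e1 e2 n' else True.

Lemma leval_coef env e :
  leval env e = \sum_(i < size env) lcoef e i *: nth 0 env i.
Proof.
elim: e => [j||e1 IH1 e2 IH2|e IH|c e IH] /=.
- have [lt_j|le_j] := ltnP j (size env); last first.
    rewrite nth_default // big1 // => i _.
    case: eqnP => [E|_]; last by rewrite scale0r.
    by move: (ltn_ord i); rewrite -E ltnNge le_j.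
  rewrite (bigD1 (Ordinal lt_j)) //= (introT eqnP (erefl j)) scale1r.
  rewrite big1 ?addr0 // => i.
  rewrite -val_eqE /= => neq_ij; case: eqnP => [E|_].
    by rewrite E eqxx in neq_ij.
  by rewrite scale0r.
- by rewrite big1 // => i _; rewrite scale0r.
- by rewrite IH1 IH2 -big_split; apply: eq_bigr => i _; rewrite scalerDl.
- by rewrite IH -sumrN; apply: eq_bigr => i _; rewrite scaleNr.
- by rewrite IH scaler_sumr; apply: eq_bigr => i _; rewrite scalerA.
Qed.

Lemma leval_eq env e1 e2 :
  lcoef_eq e1 e2 (size env) -> leval env e1 = leval env e2.
Proof.
move=> eq12; rewrite !leval_coef; apply: eq_bigr => i _; congr (_ *: _).
move: (size env) eq12 i => n; elim: n => [|n IH] /= eq12 [i lt_i] //=.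
case: eq12 => eq_n eq12; move: lt_i; rewrite ltnS leq_eqVlt.
move=> /predU1P[->//|lt_i].
exact: (IH eq12 (Ordinal lt_i)).
Qed.

End LinearExpressions.

Ltac atom_index x env :=
  lazymatch env with
  | x :: _ => constr:(0%N)
  | _ :: ?env' => let i := atom_index x env' in constr:(S i)
  end.

Ltac add_atom x env :=
  match env with
  | _ => let i := atom_index x env in env
  | _ => constr:(x :: env)
  end.

Ltac atoms u env :=
  lazymatch u with
  | 0%R => env
  | (?v + ?w)%R => let env' := atoms v env in atoms w env'
  | (- ?v)%R => atoms v env
  | (_ *: ?v)%R => atoms v env
  | _ => add_atom u env
  end.

Ltac reify R u env :=
  lazymatch u with
  | 0%R => constr:(@LZero R)
  | (?v + ?w)%R =>
      let e1 := reify R v env in let e2 := reify R w env in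
      constr:(@LAdd R e1 e2)
  | (- ?v)%R => let e1 := reify R v env in constr:(@LOpp R e1)
  | (?c *: ?v)%R => let e1 := reify R v env in constr:(@LScale R c e1)
  | _ => let i := atom_index u env in constr:(@LAtom R i)
  end.

(* Reduces an equality in an R-module to the equality of the coefficients of
   each atom; the equalities within reach of field are discharged. *)
Ltac module_eq R :=
  lazymatch goal with
  | |- @eq ?T ?u ?v =>
      let env0 := constr:(@nil T) in
      let env1 := atoms u env0 in
      let env := atoms v env1 in
      let e1 := reify R u env in
      let e2 := reify R v env in
      refine (@leval_eq R _ env e1 e2 _);
      cbn [lcoef_eq lcoef size eqn];
      repeat (apply: conj); try exact: I; try (by field)
  end.

(** * Multilinear maps and generators *)

Section Bilinear.
Variables (R : realType) (V : lmodType R) (mu : V -> V -> V).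
Hypothesis mu_bilinear :
  (forall x, linear (mu x)) /\ (forall y, linear (mu ^~ y)).

Let muL y : {linear V -> V} := HB.pack (mu ^~ y)
  (GRing.isLinear.Build R V V *:%R (mu ^~ y) (mu_bilinear.2 y)).
Let muR x : {linear V -> V} := HB.pack (mu x)
  (GRing.isLinear.Build R V V *:%R (mu x) (mu_bilinear.1 x)).

Lemma bilin0l y : mu 0 y = 0.
Proof. exact: (raddf0 (muL y)). Qed.
Lemma bilin0r x : mu x 0 = 0.
Proof. exact: (raddf0 (muR x)). Qed.
Lemma bilinDl x1 x2 y : mu (x1 + x2) y = mu x1 y + mu x2 y.
Proof. exact: (raddfD (muL y)). Qed.
Lemma bilinDr x y1 y2 : mu x (y1 + y2) = mu x y1 + mu x y2.
Proof. exact: (raddfD (muR x)). Qed.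
Lemma bilinNl x y : mu (- x) y = - mu x y.
Proof. exact: (raddfN (muL y)). Qed.
Lemma bilinNr x y : mu x (- y) = - mu x y.
Proof. exact: (raddfN (muR x)). Qed.
Lemma bilinZl c x y : mu (c *: x) y = c *: mu x y.
Proof. exact: (linearZ_LR (muL y)). Qed.
Lemma bilinZr c x y : mu x (c *: y) = c *: mu x y.
Proof. exact: (linearZ_LR (muR x)). Qed.

Definition bilinE :=
  (bilin0l, bilin0r, bilinDl, bilinDr, bilinNl, bilinNr, bilinZl, bilinZr).

End Bilinear.

Section BilinearClosure.
Variables (R : realType) (L : superspace R).
Implicit Types (mu nu : L -> L -> L) (f g : L -> L) (t : L -> R).

Lemma bilinear_add mu nu : bilinear_product mu -> bilinear_product nu ->
  bilinear_product (fun x y => mu x y + nu x y).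
Proof.
move=> bmu bnu; split=> [x|y] c u v; rewrite !(bilinE bmu) !(bilinE bnu);
  module_eq R.
Qed.

Lemma bilinear_scale d mu : bilinear_product mu ->
  bilinear_product (fun x y => d *: mu x y).
Proof. by move=> bmu; split=> [x|y] c u v; rewrite !(bilinE bmu); module_eq R. Qed.

Lemma bilinear_comp mu f g : bilinear_product mu -> linear f -> linear g ->
  bilinear_product (fun x y => mu (f x) (g y)).
Proof.
by move=> bmu lf lg; split=> [x|y] c u v; rewrite ?lf ?lg !(bilinE bmu).
Qed.

Lemma bilinear_swap mu : bilinear_product mu ->
  bilinear_product (fun x y => mu y x).
Proof. by case. Qed.

Lemma bilinear_scalar t f : linear_for *%R t -> linear f ->
  bilinear_product (fun x y => t x *: f y).
Proof.
by move=> lt lf; split=> [x|y] c u v; rewrite ?lf ?lt; module_eq R.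
Qed.

End BilinearClosure.

Section Multilinear.
Variables (R : realType) (V : lmodType R).
Implicit Types (S T : V -> V -> V -> V) (mu : V -> V -> V).

Definition linear3 T : Prop :=
  [/\ forall y z, linear (fun x => T x y z), forall x z, linear (T x ^~ z) &
      forall x y, linear (T x y)].

Lemma linear3_left mu :
  (forall x, linear (mu x)) /\ (forall y, linear (mu ^~ y)) ->
  linear3 (fun x y z => mu (mu x y) z).
Proof. by move=> bmu; split=> ? ? c u v; rewrite !(bilinE bmu). Qed.

Lemma linear3_right mu :
  (forall x, linear (mu x)) /\ (forall y, linear (mu ^~ y)) ->
  linear3 (fun x y z => mu x (mu y z)).
Proof. by move=> bmu; split=> ? ? c u v; rewrite !(bilinE bmu). Qed.

Lemma linear3_swap12 T : linear3 T -> linear3 (fun x y z => T y x z).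
Proof. by case=> T1 T2 T3; split=> *; [exact: T2|exact: T1|exact: T3]. Qed.

Lemma linear3_swap23 T : linear3 T -> linear3 (fun x y z => T x z y).
Proof. by case=> T1 T2 T3; split=> *; [exact: T1|exact: T3|exact: T2]. Qed.

Lemma linear3_add S T : linear3 S -> linear3 T ->
  linear3 (fun x y z => S x y z + T x y z).
Proof.
move=> [S1 S2 S3] [T1 T2 T3]; split=> ? ? c u v;
  rewrite ?S1 ?T1 ?S2 ?T2 ?S3 ?T3; module_eq R.
Qed.

Lemma linear3_opp T : linear3 T -> linear3 (fun x y z => - T x y z).
Proof.
move=> [T1 T2 T3]; split=> ? ? c u v; rewrite ?T1 ?T2 ?T3; module_eq R.
Qed.

Lemma linear3_scale d T : linear3 T -> linear3 (fun x y z => d *: T x y z).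
Proof.
move=> [T1 T2 T3]; split=> ? ? c u v; rewrite ?T1 ?T2 ?T3; module_eq R.
Qed.

End Multilinear.

(* Every identity below is a combination of (x.y).z and x.(y.z) with permuted
   arguments, whence these cases. *)
Ltac trilinearity bmu :=
  repeat first
    [ exact: (linear3_left bmu) | exact: (linear3_right bmu)
    | exact: (linear3_swap12 (linear3_left bmu))
    | exact: (linear3_swap12 (linear3_right bmu))
    | exact: (linear3_swap23 (linear3_left bmu))
    | exact: (linear3_swap23 (linear3_right bmu))
    | apply: linear3_add | apply: linear3_opp | apply: linear3_scale ].

Section Generators.
Variables (R : realType) (L : superspace R) (G : bool -> L -> Prop).
Implicit Types (x y z : L) (a b : bool) (mu : L -> L -> L).

Lemma homogeneous_lin a c x y :
  homogeneous a x -> homogeneous a y -> homogeneous a (c *: x + y : L).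
Proof. by case: a => /= -> ->; rewrite scaler0 addr0. Qed.

Lemma homogeneous_zero a : homogeneous a (0 : L).
Proof. by case: a. Qed.

(** Says that the homogeneous elements of parity a lie in the linear span of G a,
    through the induction principle that this provides. *)
Definition generating : Prop := forall a (P : L -> Prop),
  P 0 -> (forall c x y, P x -> P y -> P (c *: x + y)) ->
  (forall x, G a x -> P x) -> forall x, homogeneous a x -> P x.

Hypothesis genG : generating.

Let lin0 (f : L -> L) : linear f -> f 0 = 0.
Proof.
move=> lf; have := lf (-1) 0 0; rewrite scaleN1r addNr => ->.
by rewrite scaleN1r addNr.
Qed.

Lemma linear_eq a (f g : L -> L) : linear f -> linear g ->
  (forall x, G a x -> f x = g x) -> forall x, homogeneous a x -> f x = g x.
Proof.
move=> lf lg fg; apply: genG => // [|c x y fgx fgy]; first by rewrite !lin0.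
by rewrite lf lg fgx fgy.
Qed.

Lemma bilinear_eq a b (mu nu : L -> L -> L) :
  bilinear_product mu -> bilinear_product nu ->
  (forall x y, G a x -> G b y -> mu x y = nu x y) ->
  forall x y, homogeneous a x -> homogeneous b y -> mu x y = nu x y.
Proof.
move=> bmu bnu munu x y hx hy; move: x hx; apply: (linear_eq (f := mu^~ y)).
- exact: bmu.2.
- exact: bnu.2.
by move=> x Gx; move: y hy; apply: linear_eq; [exact: bmu.1|exact: bnu.1|auto].
Qed.

Lemma trilinear_eq a b c (S T : L -> L -> L -> L) : linear3 S -> linear3 T ->
  (forall x y z, G a x -> G b y -> G c z -> S x y z = T x y z) ->
  forall x y z, homogeneous a x -> homogeneous b y -> homogeneous c z ->
  S x y z = T x y z.
Proof.
move=> [S1 S2 S3] [T1 T2 T3] ST x y z hx hy hz.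
move: x hx; apply: (linear_eq (S1 y z) (T1 y z)) => x Gx.
move: y hy; apply: (linear_eq (S2 x z) (T2 x z)) => y Gy.
by move: z hz; apply: (linear_eq (S3 x y) (T3 x y)) => z Gz; exact: ST.
Qed.

Lemma even_on_generators mu : bilinear_product mu ->
  (forall a b x y, G a x -> G b y -> homogeneous (a (+) b) (mu x y)) ->
  even_product mu.
Proof.
move=> bmu emu a b x y hx hy.
move: x hx; apply: genG => [|d x1 x2 h1 h2|x Gx].
- by rewrite (bilinE bmu); exact: homogeneous_zero.
- by rewrite !(bilinE bmu); exact: homogeneous_lin.
move: y hy; apply: genG => [|d y1 y2 h1 h2|y Gy]; last exact: emu.
- by rewrite (bilinE bmu); exact: homogeneous_zero.
- by rewrite !(bilinE bmu); exact: homogeneous_lin.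
Qed.

Lemma LSSA_on_generators mu : bilinear_product mu ->
  (forall a b x y, G a x -> G b y -> homogeneous (a (+) b) (mu x y)) ->
  (forall a b c x y z, G a x -> G b y -> G c z ->
     associator mu x y z = koszul R a b *: associator mu y x z) ->
  is_LSSA mu.
Proof.
move=> bmu emu amu; split=> //; first exact: even_on_generators.
move=> a b c; apply: trilinear_eq => // [||x y z]; last exact: amu.
  by rewrite /associator; trilinearity bmu.
by rewrite /associator; trilinearity bmu.
Qed.

(** The axiom leaves z arbitrary, whereas generators are homogeneous: z is split
    into its even and odd parts. *)
Lemma right_supercommutative_on_generators mu : bilinear_product mu ->
  (forall a b c x y z, G a x -> G b y -> G c z ->
     mu (mu z x) y = koszul R a b *: mu (mu z y) x) ->
  forall a b x y z, homogeneous a x -> homogeneous b y ->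
    mu (mu z x) y = koszul R a b *: mu (mu z y) x.
Proof.
move=> bmu rmu a b x y z hx hy.
have hmu c u : homogeneous c u ->
    mu (mu u x) y = koszul R a b *: mu (mu u y) x.
  move=> hu; move: u x y hu hx hy.
  apply: (trilinear_eq (a := c) (b := a) (c := b)
    (S := fun u x y => mu (mu u x) y)
    (T := fun u x y => koszul R a b *: mu (mu u y) x)).
  - exact: linear3_left.
  - by apply: linear3_scale; exact: (linear3_swap23 (linear3_left bmu)).
  - by move=> u x y Gu Gx Gy; exact: (rmu _ _ c).
have -> : z = (z.1, 0) + (0, z.2).
  by case: z => z1 z2; congr pair; rewrite /= (addr0, add0r).
by rewrite !(bilinE bmu) scalerDr (hmu false) // (hmu true).
Qed.

Lemma BN_on_generators mu : bilinear_product mu ->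
  (forall a b x y, G a x -> G b y -> homogeneous (a (+) b) (mu x y)) ->
  (forall a b (c : bool) x y z, (a + b + c <= 1)%N -> G a x -> G b y -> G c z ->
     mu (mu x y) z - mu x (mu y z) = mu (mu y x) z - mu y (mu x z)) ->
  (forall a b (c : bool) x y z, (a + b + c <= 1)%N -> G a x -> G b y -> G c z ->
     mu (mu x y) z = mu (mu x z) y) ->
  (forall x y, G true x -> G true y -> mu x y = mu y x) ->
  (forall x y z, G true x -> G true y -> G false z ->
     mu (mu x y) z = mu (mu x z) y) ->
  (forall x y z, G false x -> G true y -> G true z ->
     mu x (mu y z) = mu (mu x y) z + mu y (mu x z)) ->
  (forall x y z, G true x -> G true y -> G true z ->
     mu x (mu y z) = mu (mu x y) z + mu (mu x z) y) ->
  is_BN mu.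
Proof.
move=> bmu emu lsym rcom osym r110 d011 d111.
split; [by split=> //; exact: even_on_generators | | |].
- move=> a b c x y z le1 hx hy hz; split.
    move: x y z hx hy hz; apply: trilinear_eq => [||x y z]; last exact: lsym.
      by trilinearity bmu.
    by trilinearity bmu.
  move: x y z hx hy hz; apply: trilinear_eq => [||x y z]; last exact: rcom.
    by trilinearity bmu.
  by trilinearity bmu.
- by apply: bilinear_eq => //; exact: bilinear_swap.
- by split; apply: trilinear_eq => //; trilinearity bmu.
Qed.

End Generators.

Section CompatibleOnGenerators.
Variables (R : realType) (g : lieSuperalgebra R) (G : bool -> g -> Prop).
Hypothesis genG : generating G.
Variable mu : g -> g -> g.
Hypothesis bmu : bilinear_product mu.

Lemma compatible_on_generators :
  (forall a b x y, G a x -> G b y ->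
     bracket x y = mu x y - koszul R a b *: mu y x) ->
  compatible mu.
Proof.
have [blie _ _ _] := bracketP g.
move=> cmu a b; apply: (bilinear_eq genG) => // [|x y]; last exact: cmu.
by split=> [x|y] c u v; rewrite !(bilinE bmu); module_eq R.
Qed.

Lemma BN_compatible_on_generators :
  (forall x y, G false x -> G false y -> bracket x y = mu x y - mu y x) ->
  (forall x y, G false x -> G true y -> bracket x y = mu x y - 2^-1 *: mu y x) ->
  (forall x y, G true x -> G true y -> bracket x y = mu x y) ->
  BN_compatible mu.
Proof.
have [blie _ alie _] := bracketP g.
move=> c00 c01 c11; split.
- apply: (bilinear_eq genG) => //.
  by split=> [x|y] c u v; rewrite !(bilinE bmu); module_eq R.
- move=> x y hx hy; have cxy : bracket x y = mu x y - 2^-1 *: mu y x.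
    move: x y hx hy; apply: (bilinear_eq genG) => //.
    by split=> [x|y] c u v; rewrite !(bilinE bmu); module_eq R.
  by split=> //; rewrite -cxy (alie _ _ _ _ hx hy) scale1r.
- exact: (bilinear_eq genG).
Qed.

End CompatibleOnGenerators.

(** * One-dimensional extensions of two-step nilpotent ideals *)

Section Parts.
Variables (R : realType) (L : superspace R).
Implicit Types (x y : L).

Definition evpart x : L := (x.1, 0).
Definition odpart x : L := (0, x.2).

Lemma evpart_linear : linear evpart.
Proof. by move=> c x y; rewrite /evpart; congr pair; rewrite /= scaler0 addr0. Qed.

Lemma odpart_linear : linear odpart.
Proof. by move=> c x y; rewrite /odpart; congr pair; rewrite /= scaler0 addr0. Qed.

Lemma evpart_homogeneous p x : homogeneous p x ->
  evpart x = if p then 0 else x.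
Proof. by rewrite /evpart; case: p x => [] [x1 x2] /= ->. Qed.

Lemma odpart_homogeneous p x : homogeneous p x ->
  odpart x = if p then x else 0.
Proof. by rewrite /odpart; case: p x => [] [x1 x2] /= ->. Qed.

End Parts.

Lemma koszulE (R : realType) p q : koszul R p q = if p && q then -1 else 1.
Proof. by rewrite /koszul; case: (p && q). Qed.

Section LineExtension.
Variables (R : realType) (g : lieSuperalgebra R).
Variables (a : g) (t : g -> R) (c : R).
Implicit Types (x y z : g) (p q : bool).

Definition in_ideal p x : Prop := homogeneous p x /\ t x = 0.

(** The ideal H is the kernel of t, and t a = 1 makes a a complement of it. The
    clauses say that t kills brackets (so H is an ideal), that H is two-step
    nilpotent, that ad a is the scalar c on [H,H], and that the even part of H
    is abelian. *)
Definition line_extension : Prop :=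
  [/\ [/\ linear_for *%R t, homogeneous false a & t a = 1],
      forall x, homogeneous true x -> t x = 0,
      forall p q x y, homogeneous p x -> homogeneous q y -> t (bracket x y) = 0,
      forall p q r x y z, in_ideal p x -> in_ideal q y -> in_ideal r z ->
        bracket x (bracket y z) = 0 &
      (forall p q x y, in_ideal p x -> in_ideal q y ->
        bracket a (bracket x y) = c *: bracket x y) /\
      (forall x y, in_ideal false x -> in_ideal false y -> bracket x y = 0)].

Hypothesis extg : line_extension.

Let t_linear : linear_for *%R t. Proof. by case: extg => [] []. Qed.
Let a_even : homogeneous false a. Proof. by case: extg => [] []. Qed.
Let ta : t a = 1. Proof. by case: extg => [] []. Qed.
Let br_bilinear : bilinear_product (@bracket R g).
Proof. by case: (bracketP g). Qed.
Let t0 : t 0 = 0.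
Proof. by have := t_linear (-1) 0 0; rewrite scaleN1r addNr mulN1r addNr. Qed.
Let tZ d x : t (d *: x) = d * t x.
Proof. by have := t_linear d x 0; rewrite t0 !addr0. Qed.
Let tD x y : t (x + y) = t x + t y.
Proof. by have := t_linear 1 x y; rewrite scale1r mul1r. Qed.

Let t_odd x : homogeneous true x -> t x = 0.
Proof. by case: extg => _ + _ _ _; apply. Qed.

Let ideal_bracket p q x y : homogeneous p x -> homogeneous q y ->
  in_ideal (p (+) q) (bracket x y).
Proof.
move=> hx hy; split; first by case: (bracketP g) => _ + _ _; apply.
by case: extg => _ _ + _ _; apply; [exact: hx|exact: hy].
Qed.

Let ideal_ad p x : in_ideal p x -> in_ideal p (bracket a x).
Proof. by case=> hx _; exact: (ideal_bracket a_even hx). Qed.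

Let nilpotent p q r x y z : in_ideal p x -> in_ideal q y -> in_ideal r z ->
  bracket x (bracket y z) = 0.
Proof. by case: extg => _ _ _ + _; apply. Qed.

Let anticomm p q x y : homogeneous p x -> homogeneous q y ->
  bracket x y = - (koszul R p q *: bracket y x).
Proof. by case: (bracketP g) => _ _ + _; apply. Qed.

Let nilpotent' p q r x y z : in_ideal p x -> in_ideal q y -> in_ideal r z ->
  bracket (bracket x y) z = 0.
Proof.
move=> Hx Hy Hz; rewrite (anticomm (ideal_bracket Hx.1 Hy.1).1 Hz.1).
by rewrite (nilpotent Hz Hx Hy) scaler0 oppr0.
Qed.

Let bracket_aa : bracket a a = 0.
Proof.
have := anticomm a_even a_even; rewrite koszulE /= scale1r => /eqP.
rewrite -addr_eq0 -mulr2n -scaler_nat scaler_eq0 pnatr_eq0 /=.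
by move/eqP.
Qed.

(* The sum of the first two terms is [a,[x,y]], as ad a is a derivation. *)
Let derivation p q x y : in_ideal p x -> in_ideal q y ->
  bracket (bracket a x) y + bracket x (bracket a y) = c *: bracket x y.
Proof.
move=> Hx Hy; have [_ _ _ jacobi] := bracketP g.
have [_ _ _ _ [eig _]] := extg; rewrite -(eig _ _ _ _ Hx Hy).
by rewrite (jacobi _ _ _ _ _ _ a_even Hx.1 Hy.1) koszulE scale1r.
Qed.

Definition ideal_part x : g := x - t x *: a.

(** On a and H this is a.a = l a, a.h = [a,h] + l h, h.a = l h, h.k = r [h,k],
    except that a.h loses s h for odd h and h.k gains q [h,k] for odd h and k.
    The formula with t and odpart makes bilinearity evident. *)
Definition line_product (l s r q : R) x y : g :=
  t x *: (bracket a y + l *: y - s *: odpart y) + t y *: (l *: ideal_part x)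
  + r *: bracket (ideal_part x) (ideal_part y)
  + q *: bracket (odpart x) (odpart y).

Definition line_generator p x : Prop := in_ideal p x \/ p = false /\ x = a.

Lemma line_generating : generating line_generator.
Proof.
move=> p P P0 PD PG x hx; case: p PG hx => PG hx.
  by apply: PG; left; split=> //; exact: t_odd.
have -> : x = t x *: a + (x - t x *: a) by rewrite addrC subrK.
apply: (PD); first by apply: PG; right.
apply: PG; left; split; first by rewrite /= hx a_even scaler0 subr0.
by rewrite -scaleNr tD tZ ta mulr1 subrr.
Qed.

Section Product.
Variables (l s r q : R).
Local Notation mu := (line_product l s r q).

Let ideal_part_linear : linear ideal_part.
Proof. by move=> d x y; rewrite /ideal_part t_linear; module_eq R. Qed.

Lemma line_product_bilinear : bilinear_product mu.
Proof.
apply: bilinear_add; last first.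
  apply: bilinear_scale; apply: bilinear_comp => //; exact: odpart_linear.
apply: bilinear_add; last by apply: bilinear_scale; apply: bilinear_comp.
apply: bilinear_add.
  apply: bilinear_scalar => // d x y.
  by rewrite odpart_linear !(bilinE br_bilinear); module_eq R.
apply: (bilinear_swap (mu := fun y x => t y *: (l *: ideal_part x))).
by apply: bilinear_scalar => // d x y; rewrite ideal_part_linear; module_eq R.
Qed.

Let bmu := line_product_bilinear.

Let ideal_part_a : ideal_part a = 0.
Proof. by rewrite /ideal_part ta scale1r subrr. Qed.

Let ideal_part_ideal p x : in_ideal p x -> ideal_part x = x.
Proof. by case=> _ tx; rewrite /ideal_part tx scale0r subr0. Qed.

Lemma line_aa : mu a a = l *: a.
Proof.
rewrite /line_product ideal_part_a ta (odpart_homogeneous a_even) bracket_aa.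
by rewrite !(bilinE br_bilinear); module_eq R.
Qed.

Lemma line_ah p x : in_ideal p x ->
  mu a x = bracket a x + (if p then l - s else l) *: x.
Proof.
move=> Hx; rewrite /line_product ideal_part_a ta (odpart_homogeneous a_even).
rewrite (odpart_homogeneous Hx.1) Hx.2 !(bilinE br_bilinear).
by case: p Hx => _; module_eq R.
Qed.

Lemma line_ha p x : in_ideal p x -> mu x a = l *: x.
Proof.
move=> Hx; rewrite /line_product (ideal_part_ideal Hx) ideal_part_a ta.
rewrite (odpart_homogeneous a_even) Hx.2 !(bilinE br_bilinear).
by module_eq R.
Qed.

Lemma line_hh p1 p2 x y : in_ideal p1 x -> in_ideal p2 y ->
  mu x y = (if p1 && p2 then r + q else r) *: bracket x y.
Proof.
move=> Hx Hy; rewrite /line_product (ideal_part_ideal Hx) (ideal_part_ideal Hy).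
rewrite (odpart_homogeneous Hx.1) (odpart_homogeneous Hy.1) Hx.2 Hy.2.
by case: p1 p2 {Hx Hy} => [] []; rewrite /= ?(bilinE br_bilinear); module_eq R.
Qed.

Lemma line_even p1 p2 x y : line_generator p1 x -> line_generator p2 y ->
  homogeneous (p1 (+) p2) (mu x y).
Proof.
case=> [Hx|[-> ->]] [Hy|[-> ->]].
- rewrite (line_hh Hx Hy) -[_ *: _]addr0; apply: homogeneous_lin.
    exact: (ideal_bracket Hx.1 Hy.1).1.
  exact: homogeneous_zero.
- rewrite (line_ha Hx) -[_ *: _]addr0 addbF; apply: homogeneous_lin Hx.1 _.
  exact: homogeneous_zero.
- rewrite (line_ah Hy) addrC; apply: homogeneous_lin Hy.1 _.
  exact: (ideal_ad Hy).1.
- rewrite line_aa -[_ *: _]addr0; apply: homogeneous_lin; first exact: a_even.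
  exact: homogeneous_zero.
Qed.

End Product.


Let ad_anticomm p x : in_ideal p x -> bracket x a = - bracket a x.
Proof. by move=> Hx; rewrite (anticomm Hx.1 a_even) koszulE andbF scale1r. Qed.

Let ad_ideal p q x y : in_ideal p x -> in_ideal q y ->
  bracket (bracket a x) y = c *: bracket x y - bracket x (bracket a y).
Proof. by move=> Hx Hy; rewrite -(derivation Hx Hy) addrK. Qed.

Let ad_bracket p q x y : in_ideal p x -> in_ideal q y ->
  bracket a (bracket x y) = c *: bracket x y.
Proof. by case: extg => _ _ _ _ [+ _]; apply. Qed.

Let even_abelian x y : in_ideal false x -> in_ideal false y ->
  bracket x y = 0.
Proof. by case: extg => _ _ _ _ [_]; apply. Qed.

(* The proof that a bracket expression x lies in H. *)
Ltac ideal_proof x :=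
  lazymatch x with
  | bracket a ?y => let Hy := ideal_proof y in constr:(ideal_ad Hy)
  | bracket ?y ?z =>
      let Hy := ideal_proof y in let Hz := ideal_proof z in
      constr:(ideal_bracket Hy.1 Hz.1)
  | _ => lazymatch goal with H : in_ideal _ x |- _ => constr:(H) end
  end.

(* One application of a multiplication rule of mu, innermost products first as
   ideal_proof fails on products. *)
Ltac product_step mu aa ah ha hh :=
  match goal with
  | |- context [mu ?x ?y] =>
      lazymatch constr:((x, y)) with
      | (a, a) => rewrite aa
      | (a, _) => let Hy := ideal_proof y in rewrite !(ah _ _ Hy)
      | (_, a) => let Hx := ideal_proof x in rewrite !(ha _ _ Hx)
      | _ => let Hx := ideal_proof x in let Hy := ideal_proof y in
             rewrite !(hh _ _ _ _ Hx Hy)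
      end
  end.

Ltac bracket_step :=
  match goal with
  | |- context [bracket ?x ?y] =>
      let Hx := ideal_proof x in let Hy := ideal_proof y in
      rewrite !(even_abelian Hx Hy)
  | |- context [bracket a a] => rewrite bracket_aa
  | |- context [bracket ?x a] =>
      let Hx := ideal_proof x in rewrite !(ad_anticomm Hx)
  | |- context [bracket a (bracket ?x ?y)] =>
      let Hx := ideal_proof x in let Hy := ideal_proof y in
      rewrite !(ad_bracket Hx Hy)
  | |- context [bracket (bracket a ?x) ?y] =>
      let Hx := ideal_proof x in let Hy := ideal_proof y in
      rewrite !(ad_ideal Hx Hy)
  | |- context [bracket ?x (bracket ?y ?z)] =>
      let Hx := ideal_proof x in let Hy := ideal_proof y in
      let Hz := ideal_proof z in rewrite !(nilpotent Hx Hy Hz)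
  | |- context [bracket (bracket ?x ?y) ?z] =>
      let Hx := ideal_proof x in let Hy := ideal_proof y in
      let Hz := ideal_proof z in rewrite !(nilpotent' Hx Hy Hz)
  end.

(* Expands all products into brackets and compares coefficients. Hx and Hy place
   in H the two arguments x and y whose brackets may occur in both orders; where
   x or y is a instead, the corresponding rewriting steps fail and are skipped. *)
Ltac line_identity bmu aa ah ha hh Hx Hy cl :=
  let mu := lazymatch type of bmu with bilinear_product ?m => m end in
  repeat (rewrite ?(bilinE bmu); product_step mu aa ah ha hh);
  repeat (rewrite ?(bilinE br_bilinear); bracket_step);
  try rewrite (anticomm Hy.1 (ideal_ad Hx).1) koszulE;
  try rewrite (anticomm Hy.1 Hx.1) koszulE;
  try rewrite (ad_ideal Hx Hy);
  rewrite /= ?cl; module_eq R.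

(** The only identity that constrains l is (a.x).y = +-(a.y).x, which reads
    (c + 2l)[x,y] = 0. *)
Lemma line_novikov : admits_Novikov g.
Proof.
pose l := - (c / 2).
pose mu := line_product l 0 2^-1 0.
have bmu : bilinear_product mu by exact: line_product_bilinear.
have aa : mu a a = l *: a by exact: line_aa.
have ah p x (Hx : in_ideal p x) : mu a x = bracket a x + l *: x.
  by rewrite /mu (line_ah _ _ _ _ Hx) subr0 if_same.
have ha p x (Hx : in_ideal p x) : mu x a = l *: x by exact: line_ha Hx.
have hh p q x y (Hx : in_ideal p x) (Hy : in_ideal q y) :
    mu x y = 2^-1 *: bracket x y.
  by rewrite /mu (line_hh _ _ _ _ Hx Hy) addr0 if_same.
have genG := line_generating.
have emu : forall p q x y, line_generator p x -> line_generator q y ->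
    homogeneous (p (+) q) (mu x y) by exact: line_even.
have cl : c = - (2 * l) by rewrite /l; field.
clearbody mu l; exists mu; split; first split.
- apply: (LSSA_on_generators genG bmu emu) => p q k x y z.
  rewrite koszulE /associator; case: p q k => [] [] [];
    case=> [Hx|[? ->]]; case=> [Hy|[? ->]]; case=> [Hz|[? ->]];
    try done; line_identity bmu aa ah ha hh Hx Hy cl.
- apply: (right_supercommutative_on_generators genG bmu) => p q k x y z.
  rewrite koszulE; case: p q k => [] [] [];
    case=> [Hx|[? ->]]; case=> [Hy|[? ->]]; case=> [Hz|[? ->]];
    try done; line_identity bmu aa ah ha hh Hx Hy cl.
apply: (compatible_on_generators genG bmu) => p q x y.
rewrite koszulE; case: p q => [] [];
  case=> [Hx|[? ->]]; case=> [Hy|[? ->]];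
  try done; line_identity bmu aa ah ha hh Hx Hy cl.
Qed.

(** For h even and v odd in H, compatibility h.v - (v.h)/2 = [h,v] holds with
    h.v = r [h,v] and v.h = r [v,h] only for r = 2/3, and (a.h).v = (a.v).h then
    asks for b = -2c/3. For odd u and v, u.v = [u,v] is imposed. *)
Lemma line_BN : admits_BN g.
Proof.
pose b := - (2 * c / 3).
pose mu := line_product b (b / 2) (2 / 3) 3^-1.
have bmu : bilinear_product mu by exact: line_product_bilinear.
have aa : mu a a = b *: a by exact: line_aa.
have ah p x (Hx : in_ideal p x) :
    mu a x = bracket a x + (if p then b / 2 else b) *: x.
  rewrite /mu (line_ah _ _ _ _ Hx); case: (p) => //.
  by congr (_ + _ *: _); field.
have ha p x (Hx : in_ideal p x) : mu x a = b *: x by exact: line_ha Hx.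
have hh p q x y (Hx : in_ideal p x) (Hy : in_ideal q y) :
    mu x y = (if p && q then 1 else 2 / 3) *: bracket x y.
  rewrite /mu (line_hh _ _ _ _ Hx Hy); case: (p && q) => //.
  by congr (_ *: _); field.
have genG := line_generating.
have emu : forall p q x y, line_generator p x -> line_generator q y ->
    homogeneous (p (+) q) (mu x y) by exact: line_even.
have cb : c = - (3 / 2 * b) by rewrite /b; field.
clearbody mu b; exists mu; split.
- apply: (BN_on_generators genG bmu emu).
  + case=> [] [] [] x y z //= _;
    case=> [Hx|[? ->]]; case=> [Hy|[? ->]]; case=> [Hz|[? ->]];
    try done; line_identity bmu aa ah ha hh Hx Hy cb.
  + case=> [] [] [] x y z //= _;
    case=> [Hx|[? ->]]; case=> [Hy|[? ->]]; case=> [Hz|[? ->]];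
    try done; line_identity bmu aa ah ha hh Hy Hz cb.
  + by move=> x y [Hx|[//]] [Hy|[//]];
      line_identity bmu aa ah ha hh Hx Hy cb.
  + by move=> x y z; case=> [Hx|[? ->]]; case=> [Hy|[? ->]]; case=> [Hz|[? ->]];
    try done; line_identity bmu aa ah ha hh Hx Hy cb.
  + by move=> x y z; case=> [Hx|[? ->]]; case=> [Hy|[? ->]]; case=> [Hz|[? ->]];
    try done; line_identity bmu aa ah ha hh Hy Hz cb.
  + by move=> x y z; case=> [Hx|[? ->]]; case=> [Hy|[? ->]]; case=> [Hz|[? ->]];
    try done; line_identity bmu aa ah ha hh Hx Hy cb.
- apply: (BN_compatible_on_generators genG bmu) => x y;
    case=> [Hx|[? ->]]; case=> [Hy|[? ->]];
    try done; line_identity bmu aa ah ha hh Hx Hy cb.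
Qed.
End LineExtension.

(** * Semidirect products with abelian kernel *)

Section SemidirectExtension.
Variables (R : realType) (g : lieSuperalgebra R) (pi : g -> g).
Implicit Types (x y z : g) (p q : bool).

Definition in_base p x : Prop := homogeneous p x /\ pi x = x.
Definition in_fiber p x : Prop := homogeneous p x /\ pi x = 0.

(** The decomposition g = B + K is given by the projection pi onto B along K: B is
    a subalgebra whose even elements are central in it, and K is an abelian
    ideal. *)
Definition semidirect_extension : Prop :=
  [/\ [/\ linear pi, forall p x, homogeneous p x -> homogeneous p (pi x) &
          forall x, pi (pi x) = pi x],
      forall p q x y, in_base p x -> in_base q y ->
        pi (bracket x y) = bracket x y,
      forall p q x y, in_base p x -> in_fiber q y -> pi (bracket x y) = 0,
      forall p q x y, in_fiber p x -> in_fiber q y -> bracket x y = 0 &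
      forall q x y, in_base false x -> in_base q y -> bracket x y = 0].

Hypothesis extg : semidirect_extension.

Let pi_linear : linear pi. Proof. by case: extg => [] []. Qed.
Let pi_homogeneous p x : homogeneous p x -> homogeneous p (pi x).
Proof. by case: extg => [] [_ + _] _ _ _ _; apply. Qed.
Let pi_idem x : pi (pi x) = pi x. Proof. by case: extg => [] []. Qed.
Let br_bilinear : bilinear_product (@bracket R g).
Proof. by case: (bracketP g). Qed.
Let br_even p q x y : homogeneous p x -> homogeneous q y ->
  homogeneous (p (+) q) (bracket x y).
Proof. by case: (bracketP g) => _ + _ _; apply. Qed.
Let anticomm p q x y : homogeneous p x -> homogeneous q y ->
  bracket x y = - (koszul R p q *: bracket y x).
Proof. by case: (bracketP g) => _ _ + _; apply. Qed.

Let base_bracket p q x y : in_base p x -> in_base q y ->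
  in_base (p (+) q) (bracket x y).
Proof.
move=> Hx Hy; split; first exact: br_even Hx.1 Hy.1.
by case: extg => _ + _ _ _; apply; [exact: Hx|exact: Hy].
Qed.

Let fiber_bracket p q x y : in_base p x -> in_fiber q y ->
  in_fiber (p (+) q) (bracket x y).
Proof.
move=> Hx Hy; split; first exact: br_even Hx.1 Hy.1.
by case: extg => _ _ + _ _; apply; [exact: Hx|exact: Hy].
Qed.

Let fiber_bracket' p q x y : in_fiber p x -> in_base q y ->
  in_fiber (p (+) q) (bracket x y).
Proof.
move=> Hx Hy; split; first exact: br_even Hx.1 Hy.1.
rewrite (anticomm Hx.1 Hy.1); have [_ pi0] := fiber_bracket Hy Hx.
have pi00 : pi 0 = 0.
  by have := pi_linear (-1) 0 0; rewrite scaleN1r addNr => ->;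
    rewrite scaleN1r addNr.
have := pi_linear (- koszul R p q) (bracket y x) 0.
by rewrite pi0 pi00 scaler0 !addr0 scaleNr.
Qed.

Let fiber_abelian p q x y : in_fiber p x -> in_fiber q y -> bracket x y = 0.
Proof. by case: extg => _ _ _ + _; apply. Qed.

Let even_central q x y : in_base false x -> in_base q y -> bracket x y = 0.
Proof. by case: extg => _ _ _ _; apply. Qed.

Let even_central' q x y : in_base false x -> in_base q y -> bracket y x = 0.
Proof.
by move=> Hx Hy; rewrite (anticomm Hy.1 Hx.1) (even_central Hx Hy) scaler0 oppr0.
Qed.

Let jacobi p q r x y z : in_base p x -> in_base q y -> in_fiber r z ->
  bracket (bracket x y) z =
  bracket x (bracket y z) - koszul R p q *: bracket y (bracket x z).
Proof.
move=> Hx Hy Hz; have [_ _ _ jac] := bracketP g.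
by rewrite (jac _ _ _ _ _ _ Hx.1 Hy.1 Hz.1) addrK.
Qed.

(** Without the s-terms: b.b' = r [b,b'], b.k = [b,k], and K multiplies everything
    to zero. The s-terms add s [b,k] for odd b and even k, s [b,b'] for odd b and
    b', and make k.b = s [k,b] for odd k and b. *)
Definition semidirect_product (r s : R) x y : g :=
  bracket (pi x) (y - pi y) + r *: bracket (pi x) (pi y)
  + s *: (bracket (odpart (pi x)) (evpart (y - pi y))
          + bracket (odpart x) (odpart (pi y))).

Definition semidirect_generator p x : Prop := in_base p x \/ in_fiber p x.

Lemma semidirect_generating : generating semidirect_generator.
Proof.
move=> p P P0 PD PG x hx.
have -> : x = 1 *: pi x + (x - pi x) by rewrite scale1r addrC subrK.
have hp := pi_homogeneous hx.
apply: (PD); apply: PG; first by left; split.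
right; split; first by rewrite -scaleN1r addrC; exact: homogeneous_lin.
by rewrite -scaleN1r addrC pi_linear pi_idem scaleN1r addNr.
Qed.

Section Product.
Variables (r s : R).
Local Notation mu := (semidirect_product r s).

Lemma semidirect_product_bilinear : bilinear_product mu.
Proof.
have co_linear : linear (fun x => x - pi x).
  by move=> d x y; rewrite pi_linear; module_eq R.
have ev_linear := @evpart_linear R g; have od_linear := @odpart_linear R g.
have od_pi_linear : linear (fun x => odpart (pi x)).
  by move=> d x y; rewrite pi_linear od_linear.
apply: bilinear_add.
  apply: bilinear_add; first exact: bilinear_comp.
  by apply: bilinear_scale; exact: bilinear_comp.
apply: bilinear_scale; apply: bilinear_add; last exact: bilinear_comp.
apply: (bilinear_comp (f := fun x => odpart (pi x))
                      (g := fun y => evpart (y - pi y))) => // d x y.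
by rewrite co_linear ev_linear.
Qed.

Lemma semidirect_bb p q x y : in_base p x -> in_base q y ->
  mu x y = (if p && q then r + s else r) *: bracket x y.
Proof.
move=> Hx Hy; rewrite /semidirect_product Hx.2 Hy.2 subrr.
rewrite !(odpart_homogeneous Hx.1) !(odpart_homogeneous Hy.1).
rewrite (evpart_homogeneous (homogeneous_zero g true)).
by case: p q {Hx Hy} => [] []; rewrite !(bilinE br_bilinear) /=; module_eq R.
Qed.

Lemma semidirect_bk p q x y : in_base p x -> in_fiber q y ->
  mu x y = (if p && ~~ q then 1 + s else 1) *: bracket x y.
Proof.
move=> Hx Hy; rewrite /semidirect_product Hx.2 Hy.2 subr0.
rewrite !(odpart_homogeneous Hx.1) (evpart_homogeneous Hy.1).
rewrite (odpart_homogeneous (homogeneous_zero g false)).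
by case: p q {Hx Hy} => [] []; rewrite !(bilinE br_bilinear) /=; module_eq R.
Qed.

Lemma semidirect_kb p q x y : in_fiber p x -> in_base q y ->
  mu x y = (if p && q then s else 0) *: bracket x y.
Proof.
move=> Hx Hy; rewrite /semidirect_product Hx.2 Hy.2 subrr.
rewrite !(odpart_homogeneous Hx.1) !(odpart_homogeneous Hy.1).
rewrite (odpart_homogeneous (homogeneous_zero g false)).
by case: p q {Hx Hy} => [] []; rewrite !(bilinE br_bilinear) /=; module_eq R.
Qed.

Lemma semidirect_kk p q x y : in_fiber p x -> in_fiber q y -> mu x y = 0.
Proof.
move=> Hx Hy; rewrite /semidirect_product Hx.2 Hy.2.
rewrite !(odpart_homogeneous (homogeneous_zero g false)).
by rewrite !(bilinE br_bilinear) /=; module_eq R.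
Qed.

Lemma semidirect_even p q x y :
  semidirect_generator p x -> semidirect_generator q y ->
  homogeneous (p (+) q) (mu x y).
Proof.
have scaled k d (u : g) : homogeneous k u -> homogeneous k (d *: u).
  move=> hu; rewrite -[_ *: _]addr0; apply: homogeneous_lin hu _.
  exact: homogeneous_zero.
case=> [Hx|Hx] [Hy|Hy].
- by rewrite (semidirect_bb Hx Hy); apply/scaled/br_even; [case: Hx|case: Hy].
- by rewrite (semidirect_bk Hx Hy); apply/scaled/br_even; [case: Hx|case: Hy].
- by rewrite (semidirect_kb Hx Hy); apply/scaled/br_even; [case: Hx|case: Hy].
- by rewrite (semidirect_kk Hx Hy); exact: homogeneous_zero.
Qed.

End Product.

(* Proofs that a bracket expression x lies in B, respectively in K. *)
Ltac base_proof x :=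
  lazymatch x with
  | bracket ?y ?z =>
      let Hy := base_proof y in let Hz := base_proof z in
      constr:(base_bracket Hy Hz)
  | _ => lazymatch goal with H : in_base _ x |- _ => constr:(H) end
  end.

Ltac fiber_proof x :=
  lazymatch x with
  | bracket ?y ?z =>
      match goal with
      | _ => let Hy := base_proof y in let Hz := fiber_proof z in
             constr:(fiber_bracket Hy Hz)
      | _ => let Hy := fiber_proof y in let Hz := base_proof z in
             constr:(fiber_bracket' Hy Hz)
      end
  | _ => lazymatch goal with H : in_fiber _ x |- _ => constr:(H) end
  end.

Ltac product_step mu bb bk kb kk :=
  match goal with
  | |- context [mu ?x ?y] =>
      let Hx := base_proof x in let Hy := base_proof y in
      rewrite !(bb _ _ _ _ Hx Hy)
  | |- context [mu ?x ?y] =>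
      let Hx := base_proof x in let Hy := fiber_proof y in
      rewrite !(bk _ _ _ _ Hx Hy)
  | |- context [mu ?x ?y] =>
      let Hx := fiber_proof x in let Hy := base_proof y in
      rewrite !(kb _ _ _ _ Hx Hy)
  | |- context [mu ?x ?y] =>
      let Hx := fiber_proof x in let Hy := fiber_proof y in
      rewrite !(kk _ _ _ _ Hx Hy)
  end.

(* The Jacobi identity precedes the rules that make [x,y] vanish: even when
   [x,y] = 0 it relates [x,[y,z]] to [y,[x,z]]. *)
Ltac bracket_step :=
  match goal with
  | |- context [bracket (bracket ?x ?y) ?z] =>
      let Hx := base_proof x in let Hy := base_proof y in
      let Hz := fiber_proof z in rewrite !(jacobi Hx Hy Hz) koszulE
  | |- context [bracket ?x ?y] =>
      let Hx := fiber_proof x in let Hy := base_proof y in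
      rewrite !(anticomm Hx.1 Hy.1) koszulE
  | |- context [bracket ?x ?y] =>
      let Hx := fiber_proof x in let Hy := fiber_proof y in
      rewrite !(fiber_abelian Hx Hy)
  | |- context [bracket ?x ?y] =>
      let Hx := base_proof x in let Hy := base_proof y in
      rewrite !(even_central Hx Hy)
  | |- context [bracket ?x ?y] =>
      let Hx := base_proof x in let Hy := base_proof y in
      rewrite !(even_central' Hy Hx)
  end.

Ltac semidirect_identity bmu bb bk kb kk :=
  let mu := lazymatch type of bmu with bilinear_product ?m => m end in
  repeat (rewrite ?(bilinE bmu); product_step mu bb bk kb kk);
  rewrite ?(bilinE bmu) /=;
  repeat (rewrite ?(bilinE br_bilinear); bracket_step);
  rewrite ?(bilinE br_bilinear) /=; try (by module_eq R).

Section LSSA.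
Local Notation mu := (semidirect_product 2^-1 0).
Let bmu : bilinear_product mu.
Proof. exact: semidirect_product_bilinear. Qed.

Let bb p q x y : in_base p x -> in_base q y -> mu x y = 2^-1 *: bracket x y.
Proof. by move=> Hx Hy; rewrite (semidirect_bb _ _ Hx Hy) addr0 if_same. Qed.

Let bk p q x y : in_base p x -> in_fiber q y -> mu x y = bracket x y.
Proof.
by move=> Hx Hy; rewrite (semidirect_bk _ _ Hx Hy) addr0 if_same scale1r.
Qed.

Let kb p q x y : in_fiber p x -> in_base q y -> mu x y = 0.
Proof. by move=> Hx Hy; rewrite (semidirect_kb _ _ Hx Hy) if_same scale0r. Qed.

Let kk p q x y : in_fiber p x -> in_fiber q y -> mu x y = 0.
Proof. exact: semidirect_kk. Qed.

Lemma semidirect_is_LSSA : is_LSSA mu.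
Proof.
move: (mu) bmu bb bk kb kk (@semidirect_even 2^-1 0) => m bm bb' bk' kb' kk' em.
apply: (LSSA_on_generators semidirect_generating bm em) => p q k x y z.
rewrite koszulE /associator; case: p q k => [] [] [];
  case=> [Hx|Hx]; case=> [Hy|Hy]; case=> [Hz|Hz];
  semidirect_identity bm bb' bk' kb' kk'.
Qed.

Lemma semidirect_compatible : compatible mu.
Proof.
move: (mu) bmu bb bk kb kk => m bm bb' bk' kb' kk'.
apply: (compatible_on_generators semidirect_generating bm) => p q x y.
rewrite koszulE; case: p q => [] []; case=> [Hx|Hx]; case=> [Hy|Hy];
  semidirect_identity bm bb' bk' kb' kk'.
by rewrite (anticomm Hy.1 Hx.1) koszulE /=; module_eq R.
Qed.

Lemma semidirect_LSSA : admits_LSSA g.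
Proof.
by exists mu; split; [exact: semidirect_is_LSSA|exact: semidirect_compatible].
Qed.

Lemma semidirect_novikov :
  (forall p q r x y z, in_base p x -> in_base q y -> in_fiber r z ->
     bracket (bracket x y) z = 0) ->
  admits_Novikov g.
Proof.
move=> derived_trivial; exists mu; split; last exact: semidirect_compatible.
split; first exact: semidirect_is_LSSA.
move: (mu) bmu bb bk kb kk => m bm bb' bk' kb' kk'.
apply: (right_supercommutative_on_generators semidirect_generating bm).
move=> p q k x y z.
rewrite koszulE; case: p q k => [] [] [];
  case=> [Hx|Hx]; case=> [Hy|Hy]; case=> [Hz|Hz];
  repeat (rewrite ?(bilinE bm); product_step m bb' bk' kb' kk');
  try rewrite (derived_trivial _ _ _ _ _ _ Hz Hx Hy);
  try rewrite (derived_trivial _ _ _ _ _ _ Hz Hy Hx);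
  semidirect_identity bm bb' bk' kb' kk'.
Qed.

End LSSA.

Ltac BN_identity bmu bb bk kb kk commute :=
  semidirect_identity bmu bb bk kb kk;
  try match goal with
  | |- context [bracket ?x (bracket ?y ?z)] =>
      let Hx := base_proof x in let Hy := base_proof y in
      let Hz := fiber_proof z in
      rewrite (commute _ _ _ _ _ _ Hx Hy Hz); by module_eq R
  end.

(** For u = b, v = b' odd in B, the identity u.(v.k) = (u.v).k + (u.k).v with k odd
    reads 2[b,[b',k]] = [[b,b'],k], and by the Jacobi identity this says that
    ad b and ad b' commute on K. If b or b' is even they commute anyway, since
    [b,b'] = 0. *)
Lemma semidirect_BN :
  (forall r x y z, in_base true x -> in_base true y -> in_fiber r z ->
     bracket x (bracket y z) = bracket y (bracket x z)) ->
  admits_BN g.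
Proof.
move=> odd_commute.
have commute p q r x y z (Hx : in_base p x) (Hy : in_base q y)
    (Hz : in_fiber r z) :
    bracket x (bracket y z) = bracket y (bracket x z).
  case: p q Hx Hy => [] [] Hx Hy; first exact: (odd_commute _ _ _ _ Hx Hy Hz).
  - have := jacobi Hx Hy Hz; rewrite (even_central' Hy Hx) koszulE scale1r.
    by rewrite (bilinE br_bilinear) => /esym/eqP; rewrite subr_eq0 => /eqP.
  - have := jacobi Hx Hy Hz; rewrite (even_central Hx Hy) koszulE scale1r.
    by rewrite (bilinE br_bilinear) => /esym/eqP; rewrite subr_eq0 => /eqP.
  - have := jacobi Hx Hy Hz; rewrite (even_central Hx Hy) koszulE scale1r.
    by rewrite (bilinE br_bilinear) => /esym/eqP; rewrite subr_eq0 => /eqP.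
pose mu := semidirect_product 0 1.
have bmu : bilinear_product mu by exact: semidirect_product_bilinear.
have bb p q x y (Hx : in_base p x) (Hy : in_base q y) :
    mu x y = (if p && q then 1 else 0) *: bracket x y.
  by rewrite /mu (semidirect_bb _ _ Hx Hy) add0r.
have bk p q x y (Hx : in_base p x) (Hy : in_fiber q y) :
    mu x y = (if p && ~~ q then 1 + 1 else 1) *: bracket x y.
  exact: (semidirect_bk _ _ Hx Hy).
have kb p q x y (Hx : in_fiber p x) (Hy : in_base q y) :
    mu x y = (if p && q then 1 else 0) *: bracket x y.
  exact: (semidirect_kb _ _ Hx Hy).
have kk p q x y (Hx : in_fiber p x) (Hy : in_fiber q y) : mu x y = 0.
  exact: semidirect_kk Hx Hy.
have genG := semidirect_generating.
have emu : forall p q x y, semidirect_generator p x ->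
    semidirect_generator q y -> homogeneous (p (+) q) (mu x y).
  exact: semidirect_even.
clearbody mu; exists mu; split.
- apply: (BN_on_generators genG bmu emu).
  + case=> [] [] [] x y z //= _;
      case=> [Hx|Hx]; case=> [Hy|Hy]; case=> [Hz|Hz];
      BN_identity bmu bb bk kb kk commute.
  + case=> [] [] [] x y z //= _;
      case=> [Hx|Hx]; case=> [Hy|Hy]; case=> [Hz|Hz];
      BN_identity bmu bb bk kb kk commute.
  + move=> x y; case=> [Hx|Hx]; case=> [Hy|Hy];
      semidirect_identity bmu bb bk kb kk.
    by rewrite (anticomm Hx.1 Hy.1) koszulE /=; module_eq R.
  + move=> x y z; case=> [Hx|Hx]; case=> [Hy|Hy]; case=> [Hz|Hz];
      BN_identity bmu bb bk kb kk commute.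
  + move=> x y z; case=> [Hx|Hx]; case=> [Hy|Hy]; case=> [Hz|Hz];
      BN_identity bmu bb bk kb kk commute.
  + move=> x y z; case=> [Hx|Hx]; case=> [Hy|Hy]; case=> [Hz|Hz];
      BN_identity bmu bb bk kb kk commute.
- apply: (BN_compatible_on_generators genG bmu) => x y;
    case=> [Hx|Hx]; case=> [Hy|Hy];
    BN_identity bmu bb bk kb kk commute.
Qed.
End SemidirectExtension.

(** * Reading decompositions off structure constants *)

Section StandardBasis.
Variables (R : realType) (m n : nat) (D : nat -> nat -> lincomb R).
Hypothesis lieD : is_Lie (@std_bracket R m n D).
Local Notation V := (stdSpace R m n).
Local Notation e := (stdBasis R m n).
Local Notation br := (@std_bracket R m n D).
Let g : lieSuperalgebra R := LieSuperalgebra lieD.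
Implicit Types (x y v : V) (i j l : nat).

Definition is_index i := (0 < i <= m + n)%N.

Lemma bracket_basis_ind (P : V -> Prop) i j : is_index i -> is_index j ->
  P 0 -> (forall d x y, P x -> P y -> P (d *: x + y)) ->
  (forall u, u \in D i j -> P (e u.2)) -> (forall u, u \in D j i -> P (e u.2)) ->
  P (br (e i) (e j)).
Proof.
move=> hi hj P0 PD Pij Pji; rewrite br_e // /basis_bracket.
have comb s : (forall u, u \in s -> P (e u.2)) -> P (combine m n s).
  rewrite /combine; elim: s => [|u s IH] Ps; first by rewrite big_nil.
  rewrite big_cons; apply: PD; first by apply: Ps; rewrite inE eqxx.
  by apply: IH => w ws; apply: Ps; rewrite inE ws orbT.
case: ifP => _; first exact: comb.
by rewrite -scaleNr -[_ *: _]addr0; apply: PD => //; exact: comb.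
Qed.

Lemma bracket_basis0 i j : is_index i -> is_index j ->
  nilp (D i j) -> nilp (D j i) -> br (e i) (e j) = 0.
Proof.
move=> hi hj /nilP Dij /nilP Dji.
apply: (bracket_basis_ind (P := fun v => v = 0)) => //.
- by move=> d x y -> ->; rewrite scaler0 addr0.
- by rewrite Dij.
- by rewrite Dji.
Qed.

Definition all_indices (P : pred nat) := all P (basis_range m n).

Lemma all_indicesP (P : pred nat) i : all_indices P -> is_index i -> P i.
Proof. by move=> /allP H hi; apply: H; rewrite mem_range. Qed.

(** P i j l has to hold for each e_l that occurs in the displayed [e_i, e_j]. *)
Definition all_terms (P : nat -> nat -> pred nat) :=
  all_indices (fun i => all_indices (fun j =>
    all (fun u => is_index u.2 && P i j u.2) (D i j))).

Lemma all_termsP P i j u : all_terms P -> is_index i -> is_index j ->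
  u \in D i j -> is_index u.2 /\ P i j u.2.
Proof.
move=> PD hi hj uD.
by have /allP/(_ _ uD)/andP[] := all_indicesP (all_indicesP PD hi) hj.
Qed.

Section Line.
Variables (k : nat) (c : R) (Z : seq nat).

(** The decomposition with a = e_k and H spanned by the other basis vectors. Z lists
    the indices of the basis vectors that span [H,H]; the conditions say that
    these commute with H, that e_k never occurs in a bracket, and that brackets
    within H stay in the span of Z and involve an odd vector. They only concern
    positions of nonzero constants, hence are decided by computation. *)
Definition line_table : bool :=
  [&& (0 < k <= m)%N, all is_index Z,
    all (fun z => all_indices (fun i =>
      (i == k) || nilp (D i z) && nilp (D z i))) Z &
    all_terms (fun i j l => (l != k) &&
      [|| i == k, j == k | (l \in Z) && ((m < i) || (m < j))%N])].

(** For z < k only the entry D z k is displayed; it then has to be empty, so that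
    the sign in [e_k, e_z] = -[e_z, e_k] is immaterial. *)
Definition line_eigenvalue : Prop := forall z, z \in Z ->
  (k <= z)%N /\ D k z = [:: (c, z)] \/ [/\ D k z = [::], D z k = [::] & c = 0].

Hypotheses (tableD : line_table) (eigenD : line_eigenvalue).

Let k_even : (0 < k <= m)%N. Proof. by case/and4P: tableD. Qed.
Let k_index : (k.-1 < m + n)%N.
Proof.
by case/andP: k_even => k0 km; rewrite prednK // (leq_trans km) // leq_addr.
Qed.
Let hk : is_index k.
Proof. by case/andP: k_even => k0 km; rewrite /is_index k0 -[k]prednK. Qed.

Let t (x : V) : R := Defs.coord x (Ordinal k_index).
Let a : V := e k.

Let t_linear : linear_for *%R t.
Proof. by move=> d x y; exact: coordP. Qed.

Let t_basis i : t (e i) = (i == k)%:R.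
Proof. by rewrite /t coord_e /= prednK //; case/andP: k_even. Qed.

Let br_bilinear : bilinear_product br. Proof. exact: br_bilinear. Qed.

Let ideal_ind p (P : V -> Prop) :
  P 0 -> (forall d x y, P x -> P y -> P (d *: x + y)) ->
  (forall i, is_index i -> i != k -> e_odd m i = p -> P (e i)) ->
  forall x, in_ideal (g := g) t p x -> P x.
Proof.
move=> P0 PD Pe x [hx tx].
suff : P (x - t x *: a) by rewrite tx scale0r subr0.
move: x hx {tx}; apply: homogeneous_ind => [|d x y Px Py|i hi pi].
- by have := t_linear (-1) 0 0; rewrite scaleN1r addNr mulN1r addNr => ->;
    rewrite scale0r subr0.
- rewrite t_linear; have -> : d *: x + y - (d * t x + t y) *: a =
    d *: (x - t x *: a) + (y - t y *: a) by module_eq R.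
  exact: PD.
- rewrite t_basis; have [->|nik] := eqVneq i k.
    by rewrite scale1r subrr.
  by rewrite scale0r subr0; exact: Pe.
Qed.

Let term_indexP i j u : is_index i -> is_index j -> u \in D i j ->
  is_index u.2 /\ u.2 != k /\
  [|| i == k, j == k | (u.2 \in Z) && ((m < i) || (m < j))%N].
Proof.
by case/and4P: tableD => _ _ _ H hi hj /(all_termsP H hi hj)[-> /andP[-> ->]].
Qed.

Let line_extensionD : line_extension (g := g) a t c.
Proof.
have central z i : z \in Z -> is_index i -> i != k -> br (e i) (e z) = 0.
  case/and4P: tableD => _ /allP ZI /allP ZD _ zZ hi nik.
  have := all_indicesP (ZD z zZ) hi; rewrite (negPf nik) /= => /andP[Diz Dzi].
  by apply: bracket_basis0 => //; exact: ZI.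
have eigen z : z \in Z -> br a (e z) = c *: e z.
  move=> zZ; have hz : is_index z by case/and4P: tableD => _ /allP/(_ z zZ).
  rewrite /a br_e // /basis_bracket.
  case: (eigenD zZ) => [[-> ->]|[-> -> ->]].
    by rewrite /combine big_cons big_nil addr0.
  by rewrite /combine big_nil scaler0 oppr0 if_same scale0r.
(* The properties of the elements of [H,H]; they pass to linear combinations. *)
pose derived v := br a v = c *: v /\
  forall p x, in_ideal (g := g) t p x -> br x v = 0.
have derived0 : derived 0.
  split=> [|p x _]; first by rewrite (bilinE br_bilinear) scaler0.
  by rewrite (bilinE br_bilinear).
have derivedD d x y : derived x -> derived y -> derived (d *: x + y).
  move=> [ax cx] [ay cy]; split=> [|p z Iz]; rewrite !(bilinE br_bilinear).
    by rewrite ax ay; module_eq R.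
  by rewrite (cx _ _ Iz) (cy _ _ Iz) scaler0 addr0.
have derivedZ z : z \in Z -> derived (e z).
  move=> zZ; split; first exact: eigen.
  move=> p; apply: ideal_ind => [|d x y|i hi nik _]; last exact: central.
    by rewrite (bilinE br_bilinear).
  by rewrite !(bilinE br_bilinear) => -> ->; rewrite scaler0 addr0.
have derived_br p q x y : in_ideal (g := g) t p x ->
    in_ideal (g := g) t q y -> derived (br x y).
  move=> Ix Iy; move: x Ix; apply: ideal_ind => [|d x1 x2|i hi nik _].
  - by rewrite (bilinE br_bilinear).
  - by rewrite !(bilinE br_bilinear); exact: derivedD.
  move: y Iy; apply: ideal_ind => [|d y1 y2|j hj njk _].
  - by rewrite (bilinE br_bilinear).
  - by rewrite !(bilinE br_bilinear); exact: derivedD.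
  apply: bracket_basis_ind => // u uD; apply: derivedZ.
    have [_ [_]] := term_indexP hi hj uD.
    by rewrite (negPf nik) (negPf njk) => /andP[].
  have [_ [_]] := term_indexP hj hi uD.
  by rewrite (negPf nik) (negPf njk) => /andP[].
split.
- split=> //; last by rewrite /a t_basis eqxx.
  have -> : false = e_odd m k.
    by rewrite /e_odd ltnNge; case/andP: k_even => _ ->.
  exact: e_homogeneous.
- move=> x; move: x; apply: homogeneous_ind => [|d x y tx ty|i hi oi].
  + by have := t_linear (-1) 0 0; rewrite scaleN1r addNr mulN1r addNr.
  + by rewrite t_linear tx ty mulr0 addr0.
  rewrite t_basis; case: eqP => // E; move: oi.
  by rewrite E /e_odd ltnNge; case/andP: k_even => _ ->.
- have t0 : t 0 = 0.
    by have := t_linear (-1) 0 0; rewrite scaleN1r addNr mulN1r addNr.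
  move=> p q x y hx hy; move: x hx.
  apply: homogeneous_ind => [|d x1 x2 /= H1 /= H2|i hi _].
  + by rewrite /= (bilinE br_bilinear).
  + by rewrite /= !(bilinE br_bilinear) t_linear H1 H2 mulr0 addr0.
  move: y hy; apply: homogeneous_ind => [|d x1 x2 /= H1 /= H2|j hj _].
  + by rewrite /= (bilinE br_bilinear).
  + by rewrite /= !(bilinE br_bilinear) t_linear H1 H2 mulr0 addr0.
  apply: (bracket_basis_ind (P := fun v => t v = 0)) => //.
  + by move=> d x y tx ty; rewrite t_linear tx ty mulr0 addr0.
  + by move=> u /(term_indexP hi hj)[_ [/negPf nuk _]]; rewrite t_basis nuk.
  + by move=> u /(term_indexP hj hi)[_ [/negPf nuk _]]; rewrite t_basis nuk.
- by move=> p q r x y z Ix Iy Iz; exact: (derived_br _ _ _ _ Iy Iz).2 Ix.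
split=> [p q x y Ix Iy|x y Ix Iy]; first exact: (derived_br _ _ _ _ Ix Iy).1.
move: x Ix; apply: ideal_ind => [|d x1 x2 /= H1 /= H2|i hi nik oi].
- by rewrite /= (bilinE br_bilinear).
- by rewrite /= !(bilinE br_bilinear) H1 H2 scaler0 addr0.
move: y Iy; apply: ideal_ind => [|d x1 x2 /= H1 /= H2|j hj njk oj].
- by rewrite /= (bilinE br_bilinear).
- by rewrite /= !(bilinE br_bilinear) H1 H2 scaler0 addr0.
move: oi oj; rewrite /e_odd => oi oj; apply: bracket_basis0 => //.
  case Dij: (D i j) => [//|u s]; have uD : u \in D i j by rewrite Dij inE eqxx.
  have [_ [_]] := term_indexP hi hj uD.
  by rewrite (negPf nik) (negPf njk) oi oj andbF.
case Dji: (D j i) => [//|u s]; have uD : u \in D j i by rewrite Dji inE eqxx.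
have [_ [_]] := term_indexP hj hi uD.
by rewrite (negPf nik) (negPf njk) oi oj andbF.
Qed.

Lemma line_table_novikov : admits_Novikov g.
Proof. exact: line_novikov line_extensionD. Qed.

Lemma line_table_BN : admits_BN g.
Proof. exact: line_BN line_extensionD. Qed.

End Line.

Section Semidirect.
Variable B : pred nat.

(** The decomposition with B and K spanned by the e_i with i in, respectively not
    in, the given set of indices. *)
Definition semidirect_table : bool :=
  all_terms (fun i j l =>
    if B i then if B j then [&& B l, (m < i)%N & (m < j)%N] else ~~ B l
    else B j && ~~ B l).

Hypothesis tableD : semidirect_table.

Let br_bilinear : bilinear_product br. Proof. exact: br_bilinear. Qed.

Definition base_part x : V :=
  (\row_i (x.1 0 i *+ B i.+1), \row_j (x.2 0 j *+ B (m + j).+1)).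

Let base_part_linear : linear base_part.
Proof.
by move=> d x y; congr pair; apply/rowP => i; rewrite !mxE mulrnDl mulrnAr.
Qed.

Let base_part0 : base_part 0 = 0.
Proof. by congr pair; apply/rowP => i; rewrite !mxE mul0rn. Qed.

Let base_part_basis i : base_part (e i) = if B i then e i else 0.
Proof.
case Bi: (B i); congr pair; apply/rowP => j; rewrite !mxE /=;
  by case: eqP => [<-|_]; rewrite ?Bi ?mul0rn.
Qed.

Let base_part_idem x : base_part (base_part x) = base_part x.
Proof.
by congr pair; apply/rowP => i; rewrite !mxE; case: (B _); rewrite ?mul0rn.
Qed.

Let base_part_homogeneous p x :
  homogeneous p x -> homogeneous p (base_part x).
Proof.
by case: p => /= x0; apply/rowP => i; rewrite !mxE x0 mxE mul0rn.
Qed.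

Local Notation in_base := (in_base (g := g) base_part).
Local Notation in_fiber := (in_fiber (g := g) base_part).

Let base_ind p (P : V -> Prop) :
  P 0 -> (forall d x y, P x -> P y -> P (d *: x + y)) ->
  (forall i, is_index i -> B i -> e_odd m i = p -> P (e i)) ->
  forall x, in_base p x -> P x.
Proof.
move=> P0 PD Pe x [hx <-]; move: x hx.
apply: homogeneous_ind => [|d x y Px Py|i hi pi].
- by rewrite base_part0.
- by rewrite base_part_linear; exact: PD.
- by rewrite base_part_basis; case: ifP => // Bi; exact: Pe.
Qed.

Let fiber_ind p (P : V -> Prop) :
  P 0 -> (forall d x y, P x -> P y -> P (d *: x + y)) ->
  (forall i, is_index i -> ~~ B i -> e_odd m i = p -> P (e i)) ->
  forall x, in_fiber p x -> P x.
Proof.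
move=> P0 PD Pe x [hx px].
suff : P (x - base_part x) by rewrite px subr0.
move: x hx {px}; apply: homogeneous_ind => [|d x y Px Py|i hi pi].
- by rewrite base_part0 subr0.
- rewrite base_part_linear.
  have -> : d *: x + y - (d *: base_part x + base_part y) =
    d *: (x - base_part x) + (y - base_part y) by module_eq R.
  exact: PD.
- by rewrite base_part_basis; case: ifP => [_|/negbT Bi];
    rewrite ?subrr ?subr0 //; exact: Pe.
Qed.

Let br0 v : (br v 0 = 0) * (br 0 v = 0).
Proof. by rewrite !(bilinE br_bilinear). Qed.

Let zero_lin (f : V -> V) : linear f ->
  forall d x y, f x = 0 -> f y = 0 -> f (d *: x + y) = 0.
Proof. by move=> lf d x y fx fy; rewrite lf fx fy scaler0 addr0. Qed.

Let semidirect_extensionD : semidirect_extension (g := g) base_part.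
Proof.
have no_term i j : is_index i -> is_index j ->
    (forall u, u \in D i j -> False) -> (forall u, u \in D j i -> False) ->
    br (e i) (e j) = 0.
  move=> hi hj Dij Dji; apply: bracket_basis0 => //.
    by case: (D i j) Dij => // u s /(_ u (mem_head _ _)).
  by case: (D j i) Dji => // u s /(_ u (mem_head _ _)).
split.
- by split; [exact: base_part_linear|exact: base_part_homogeneous|].
- move=> p q x y Ix Iy.
  apply/eqP; rewrite -subr_eq0; apply/eqP.
  pose f v := base_part v - v.
  have lf : linear f.
    by move=> d u v; rewrite /f base_part_linear; module_eq R.
  rewrite -[LHS]/(f (br x y)).
  move: x Ix; apply: base_ind => [|d x1 x2 /= H1 /= H2|i hi Bi oi].
  + by rewrite br0 /f base_part0 subr0.
  + by rewrite !(bilinE br_bilinear); exact: zero_lin.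
  move: y Iy; apply: base_ind => [|d x1 x2 /= H1 /= H2|j hj Bj oj].
  + by rewrite br0 /f base_part0 subr0.
  + by rewrite !(bilinE br_bilinear); exact: zero_lin.
  apply: (bracket_basis_ind (P := fun v => f v = 0)) => //.
  + by rewrite /f base_part0 subr0.
  + exact: zero_lin.
  + move=> u /(all_termsP tableD hi hj)[_]; rewrite Bi Bj => /andP[Bu _].
    by rewrite /f base_part_basis Bu subrr.
  + move=> u /(all_termsP tableD hj hi)[_]; rewrite Bi Bj => /andP[Bu _].
    by rewrite /f base_part_basis Bu subrr.
- move=> p q x y Ix Iy.
  move: x Ix; apply: base_ind => [|d x1 x2 /= H1 /= H2|i hi Bi oi].
  + by rewrite /= br0 base_part0.
  + by rewrite /= !(bilinE br_bilinear); exact: zero_lin.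
  move: y Iy; apply: fiber_ind => [|d x1 x2 /= H1 /= H2|j hj Bj oj].
  + by rewrite /= br0 base_part0.
  + by rewrite /= !(bilinE br_bilinear); exact: zero_lin.
  apply: (bracket_basis_ind (P := fun v => base_part v = 0)) => //.
  + exact: zero_lin.
  + move=> u /(all_termsP tableD hi hj)[_]; rewrite Bi (negPf Bj) => /negPf Bu.
    by rewrite base_part_basis Bu.
  + move=> u /(all_termsP tableD hj hi)[_]; rewrite Bi (negPf Bj) => /negPf Bu.
    by rewrite base_part_basis Bu.
- move=> p q x y Ix Iy.
  move: x Ix; apply: fiber_ind => [|d x1 x2 /= H1 /= H2|i hi Bi oi].
  + by rewrite /= br0.
  + by rewrite /= !(bilinE br_bilinear) H1 H2 scaler0 addr0.
  move: y Iy; apply: fiber_ind => [|d x1 x2 /= H1 /= H2|j hj Bj oj].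
  + by rewrite /= br0.
  + by rewrite /= !(bilinE br_bilinear) H1 H2 scaler0 addr0.
  apply: no_term => // u.
    by move=> /(all_termsP tableD hi hj)[_]; rewrite (negPf Bi) (negPf Bj).
  by move=> /(all_termsP tableD hj hi)[_]; rewrite (negPf Bi) (negPf Bj).
move=> q x y Ix Iy.
move: x Ix; apply: base_ind => [|d x1 x2 /= H1 /= H2|i hi Bi oi].
- by rewrite /= br0.
- by rewrite /= !(bilinE br_bilinear) H1 H2 scaler0 addr0.
move: y Iy; apply: base_ind => [|d x1 x2 /= H1 /= H2|j hj Bj oj].
- by rewrite /= br0.
- by rewrite /= !(bilinE br_bilinear) H1 H2 scaler0 addr0.
move: oi; rewrite /e_odd => oi; apply: no_term => // u.
  by move=> /(all_termsP tableD hi hj)[_]; rewrite Bi Bj oi !andbF.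
by move=> /(all_termsP tableD hj hi)[_]; rewrite Bi Bj oi !andbF.
Qed.

Lemma semidirect_table_LSSA : admits_LSSA g.
Proof. exact: semidirect_LSSA semidirect_extensionD. Qed.

Lemma semidirect_table_novikov :
  all_terms (fun i j l => B i && B j ==>
    all_indices (fun k => B k || nilp (D l k) && nilp (D k l))) ->
  admits_Novikov g.
Proof.
move=> derivedD; apply: (semidirect_novikov semidirect_extensionD).
move=> p q r x y z Ix Iy Iz.
move: z Iz; apply: fiber_ind => [|d z1 z2 /= H1 /= H2|k hk Bk _].
- by rewrite /= br0.
- by rewrite /= !(bilinE br_bilinear) H1 H2 scaler0 addr0.
move: x Ix; apply: base_ind => [|d x1 x2 /= H1 /= H2|i hi Bi _].
- by rewrite /= !br0.
- by rewrite /= !(bilinE br_bilinear) H1 H2 scaler0 addr0.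
move: y Iy; apply: base_ind => [|d x1 x2 /= H1 /= H2|j hj Bj _].
- by rewrite /= !br0.
- by rewrite /= !(bilinE br_bilinear) H1 H2 scaler0 addr0.
have derived_basis i' j' u : is_index i' -> is_index j' -> B i' -> B j' ->
    u \in D i' j' -> br (e u.2) (e k) = 0.
  move=> hi' hj' Bi' Bj' /(all_termsP derivedD hi' hj')[hu].
  rewrite Bi' Bj' => /all_indicesP/(_ hk); rewrite (negPf Bk) => /andP[Duk Dku].
  exact: bracket_basis0.
apply: (bracket_basis_ind (P := fun v => br v (e k) = 0)) => //.
- by rewrite br0.
- by move=> d u v H1 H2; rewrite !(bilinE br_bilinear) H1 H2 scaler0 addr0.
- by move=> u; exact: (derived_basis i j u hi hj Bi Bj).
- by move=> u; exact: (derived_basis j i u hj hi Bj Bi).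
Qed.

Lemma semidirect_table_BN :
  all_indices B \/
  all_indices (fun i => all_indices (fun j =>
    [&& B i, B j, m < i & m < j]%N ==> (i == j))) ->
  admits_BN g.
Proof.
move=> fewD; apply: (semidirect_BN semidirect_extensionD).
move=> r x y z Ix Iy Iz.
move: z Iz; apply: fiber_ind => [|d z1 z2 /= H1 /= H2|k hk Bk _].
- by rewrite /= !br0.
- by rewrite /= !(bilinE br_bilinear) H1 H2.
move: x Ix; apply: base_ind => [|d x1 x2 /= H1 /= H2|i hi Bi oi].
- by rewrite /= !br0.
- by rewrite /= !(bilinE br_bilinear) H1 H2.
move: y Iy; apply: base_ind => [|d x1 x2 /= H1 /= H2|j hj Bj oj].
- by rewrite /= !br0.
- by rewrite /= !(bilinE br_bilinear) H1 H2.
case: fewD => [/all_indicesP/(_ hk)|oneD]; first by rewrite (negPf Bk).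
have /all_indicesP/(_ hj) := all_indicesP oneD hi.
by move: oi oj; rewrite Bi Bj /e_odd => -> -> /= /eqP ->.
Qed.

End Semidirect.
End StandardBasis.

(** * Obstruction to Novikov structures *)

(** Write R, L for right and left multiplications, u = e2.e4 and w = e3.e4. As R_e4
    squares to zero, u.e4 = w.e4 = 0, and e1.e4 = 0 because e1 is a multiple of
    e4.e4; then e4.e1 = 0 as well. Since L_e4 squared is (s/2) L_e1, right
    supercommutativity gives e4.(e4.e2) = -w and e4.w = (s/2) e3 - s u. Writing
    w = c e1 + d e2, the relation w.e4 = 0 becomes d u = 0. If d = 0 then e4.w = 0,
    so u = e3/2, w = 0 and e4.(e4.e2) = 0 forces e2 = 0. If u = 0 then
    w = -(s/4) e2, and the two values (s/4) e3 and (s/2) e3 of e4.w force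
    e3 = 0. *)
Lemma no_novikov (R : realType) (g : lieSuperalgebra R) (e1 e2 e3 e4 : g)
    (s : R) :
  s != 0 -> e2 != 0 -> e3 != 0 ->
  homogeneous false e1 -> homogeneous false e2 ->
  homogeneous true e3 -> homogeneous true e4 ->
  (forall x : g, homogeneous false x ->
     exists c d : R, x = c *: e1 + d *: e2) ->
  bracket e1 e4 = 0 -> bracket e2 e4 = e3 -> bracket e4 e4 = s *: e1 ->
  bracket e3 e4 = - (s / 2) *: e2 ->
  ~ admits_Novikov g.
Proof.
move=> s0 /eqP e2_neq0 /eqP e3_neq0 h1 h2 h3 h4 span12 b14 b24 b44 b34.
case=> mu [[[bmu evenmu lmu] rmu] cmu].
have s20 : s / 2 != 0 by rewrite mulf_neq0 // invr_neq0 // pnatr_eq0.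
have double0 (v : g) : v = - v -> v = 0.
  move/eqP; rewrite -addr_eq0 -mulr2n -scaler_nat scaler_eq0 pnatr_eq0 /=.
  by move/eqP.
have scale0 (d : R) (v : g) : d != 0 -> d *: v = 0 -> v = 0.
  by move=> d0 /eqP; rewrite scaler_eq0 (negPf d0) => /eqP.
have m44 : mu e4 e4 = (s / 2) *: e1.
  have := cmu _ _ _ _ h4 h4; rewrite b44 koszulE /= scaleN1r opprK => E.
  by rewrite mulrC -scalerA E; module_eq R.
have r44 z : mu (mu z e4) e4 = 0.
  by apply: double0; have := rmu _ _ _ _ z h4 h4; rewrite koszulE scaleN1r.
have l44 z c : homogeneous c z -> mu (mu e4 e4) z = mu e4 (mu e4 z).
  move=> hz; apply/eqP; rewrite -subr_eq0; apply/eqP; apply: double0.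
  by have := lmu _ _ _ _ _ _ h4 h4 hz; rewrite koszulE scaleN1r.
have m14 : mu e1 e4 = 0.
  by apply: (scale0 _ _ s20); rewrite -(bilinZl bmu) -m44 r44.
have m41 : mu e4 e1 = 0.
  have := cmu _ _ _ _ h1 h4; rewrite b14 m14 koszulE scale1r sub0r.
  by move/esym/eqP; rewrite oppr_eq0 => /eqP.
pose u := mu e2 e4; pose w := mu e3 e4.
have m42 : mu e4 e2 = u - e3.
  have := cmu _ _ _ _ h2 h4; rewrite b24 koszulE scale1r => ->.
  by rewrite /u; module_eq R.
have m43 : mu e4 e3 = - (s / 2) *: e2 - w.
  have := cmu _ _ _ _ h3 h4; rewrite b34 koszulE scaleN1r opprK => ->.
  by rewrite /w; module_eq R.
have m4_42 : mu e4 (mu e4 e2) = - w.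
  rewrite -(l44 _ _ h2) (rmu _ _ _ _ _ h4 h2) koszulE scale1r m42.
  by rewrite !(bilinE bmu) r44 sub0r.
have m4w : mu e4 w = (s / 2) *: e3 - s *: u.
  have E : mu e4 (mu e4 e3) = (s / 2) *: u.
    rewrite -(l44 _ _ h3) (rmu _ _ _ _ _ h4 h3) koszulE /= m43 /u /w.
    by rewrite !(bilinE bmu) r44; module_eq R.
  have -> : mu e4 w = - (s / 2) *: (u - e3) - mu e4 (mu e4 e3).
    by rewrite m43 -m42 !(bilinE bmu); module_eq R.
  by rewrite E; module_eq R.
have hw : homogeneous false w by exact: (evenmu true true).
have [c [d ew]] := span12 w hw.
have we4 : mu w e4 = 0 by exact: r44.
have du0 : d *: u = 0.
  by move: we4; rewrite ew !(bilinE bmu) m14 scaler0 add0r.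
have m4w' : mu e4 w = d *: (u - e3).
  by rewrite ew !(bilinE bmu) m41 m42 scaler0 add0r.
move/eqP: du0; rewrite scaler_eq0 => /orP[/eqP d0|/eqP u0].
  have eu : u = 2^-1 *: e3.
    have : (s / 2) *: e3 - s *: u = 0 by rewrite -m4w m4w' d0 scale0r.
    move/subr0_eq => E; have -> : u = s^-1 *: (s *: u).
      by rewrite scalerA mulVf // scale1r.
    by rewrite -E scalerA; congr (_ *: _); field.
  have w0 : w = 0.
    apply: (scale0 2^-1); first by rewrite invr_neq0 // pnatr_eq0.
    by rewrite /w -(bilinZl bmu) -eu /u r44.
  apply: e2_neq0; apply: (scale0 _ _ s20); apply: (scale0 2^-1).
    by rewrite invr_neq0 // pnatr_eq0.
  have := m4_42; rewrite w0 oppr0 m42 eu => <-.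
  have -> : 2^-1 *: e3 - e3 = - (2^-1 *: e3) by module_eq R.
  by rewrite !(bilinE bmu) m43 w0; module_eq R.
have ew2 : w = - (s / 4) *: e2.
  have := m4_42; rewrite m42 u0 sub0r (bilinE bmu) m43 => E.
  have -> : w = 2^-1 *: (w - - w) by module_eq R.
  by rewrite -E; module_eq R.
apply: e3_neq0; apply: (scale0 _ _ s20); apply: (scale0 2^-1).
  by rewrite invr_neq0 // pnatr_eq0.
have : mu e4 w = (s / 4) *: e3.
  by rewrite ew2 !(bilinE bmu) m42 u0; module_eq R.
rewrite m4w u0 => E.
have -> : 2^-1 *: (s / 2 *: e3) = (s / 2 *: e3 - s *: 0) - (s / 4) *: e3.
  by module_eq R.
by rewrite E subrr.
Qed.

(** * The list *)

(** The index k of a = e_k, the eigenvalue c and the indices that span [H,H], for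
    the algebras that are line extensions. *)
Definition line_data (R : realType) (g : listed R) : option (nat * R * seq nat) :=
  match g with
  | D5 => Some (1, 1%R, [:: 3])
  | D10 q => Some (1, (q + 1)%R, [:: 3])
  | D7 _ _ _ _ | D8 _ _ | D9 _ _ _ | D11 _ _ _ _ _ | D12 | D13 _ _
  | D14 _ _ _ _ | D15 | D16 => Some (1, 0%R, [::])
  | D1 => Some (2, 0%R, [::])
  | D2 _ _ | D3 _ _ _ => Some (3, 0%R, [::])
  | D7_half_half_1 | D7_half_half_2 | D7_half_half_3 | D7_1subp_p _ _ | D8_half
  | D9_half _ _ | C11_A | C1half_A | D3_mhalf _ _ | D2_mhalf_1 | D2_mhalf_2 =>
      Some (1, 1%R, [:: 2])
  | C2m1_A | C3_A | C50_A => Some (1, 0%R, [:: 2])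
  | A31_A => Some (2, 0%R, [:: 1])
  | D6 | D10_0_1 | D10_0_2 | A11A11_2A_1 | A11A11_2A_2 | A11A11_2A_3 _ _
  | A11A11_2A_4 _ _ | A11_3A_1 | A11_3A_2 => None
  end%N.

Lemma line_dataP (R : realType) (g : listed R) k c Z :
  line_data g = Some (k, c, Z) ->
  line_table (evdim g) (odddim g) (displayed g) k Z /\
  line_eigenvalue (displayed g) k c Z.
Proof.
case: g => *; match goal with H : line_data _ = Some _ |- _ => move: H end;
  move=> // [<- <- <-].
all: split; first by vm_compute.
all: move=> z; rewrite ?inE //= => /eqP ->; by [left|right].
Qed.

Lemma line_listed (R : realType) (g : listed R) : line_data g <> None ->
  admits_Novikov (listed_Lie g) /\ admits_BN (listed_Lie g).
Proof.
case data: (line_data g) => [[[k c] Z]|//] _.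
have [tableD eigenD] := line_dataP data; split.
  exact: line_table_novikov tableD eigenD.
exact: line_table_BN tableD eigenD.
Qed.

(** B is the even part for D6, the span of e1 and e4 for the two exceptional
    algebras, and everything for the remaining algebras without line data, which
    are two-step nilpotent. *)
Definition base_indices (R : realType) (g : listed R) : pred nat :=
  match g with
  | D6 => fun i => (i <= 2)%N
  | D10_0_1 | D10_0_2 => fun i => (i == 1) || (i == 4)
  | _ => fun i => true
  end.

Lemma semidirect_listed (R : realType) (g : listed R) : line_data g = None ->
  admits_LSSA (listed_Lie g) /\ admits_BN (listed_Lie g).
Proof.
move=> data.
have tableD : semidirect_table (evdim g) (odddim g) (displayed g)
    (base_indices g).
  by case: g data => //= *; vm_compute.
split; first exact: semidirect_table_LSSA tableD.
apply: semidirect_table_BN tableD _.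
by case: g data => //= *; by [left|right].
Qed.

Lemma semidirect_listed_novikov (R : realType) (g : listed R) :
  line_data g = None -> g <> D10_0_1 R -> g <> D10_0_2 R ->
  admits_Novikov (listed_Lie g).
Proof.
move=> data not1 not2.
have tableD : semidirect_table (evdim g) (odddim g) (displayed g)
    (base_indices g).
  by case: g data {not1 not2} => //= *; vm_compute.
apply: semidirect_table_novikov tableD _.
by case: g data not1 not2 => //= *; vm_compute.
Qed.

Lemma D10_0_no_novikov (R : realType) (D : nat -> nat -> lincomb R) (s : R)
    (lieD : is_Lie (@std_bracket R 2 2 D)) : s != 0 ->
  D 1 4 = [::] -> D 2 4 = [:: (1, 3)] ->
  D 4 4 = [:: (s, 1)] -> D 3 4 = [:: (- (s / 2), 2)] ->
  ~ admits_Novikov (LieSuperalgebra lieD).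
Proof.
move=> s0 d14 d24 d44 d34.
pose e := stdBasis R 2 2.
have nonzero i : (0 < i <= 4)%N -> e i != 0.
  case: i => // i /= lt_i; apply/eqP.
  move/(congr1 (@Defs.coord R 2 2 ^~ (Ordinal lt_i))).
  rewrite coord_e eqxx /Defs.coord row_mx0 mxE => /eqP.
  by rewrite oner_eq0.
apply: (@no_novikov R (LieSuperalgebra lieD) (e 1%N) (e 2%N) (e 3%N) (e 4%N) s).
- exact: s0.
- exact: nonzero.
- exact: nonzero.
- exact: (@e_homogeneous R 2 2 1).
- exact: (@e_homogeneous R 2 2 2).
- exact: (@e_homogeneous R 2 2 3).
- exact: (@e_homogeneous R 2 2 4).
- apply: (homogeneous_ind (m := 2) (n := 2)) => [|d x y [c1 [d1 ->]] [c2 [d2 ->]]|].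
  + by exists 0, 0; rewrite !scale0r addr0.
  + by exists (d * c1 + c2), (d * d1 + d2); module_eq R.
  case=> [|[|[|[|[|]]]]] //= _ _.
    by exists 1, 0; rewrite scale1r scale0r addr0.
  by exists 0, 1; rewrite scale1r scale0r add0r.
- by rewrite /= /e br_e // /basis_bracket /= d14 /combine big_nil.
- by rewrite /= /e br_e // /basis_bracket /= d24 /combine big_cons big_nil addr0 scale1r.
- by rewrite /= /e br_e // /basis_bracket /= d44 /combine big_cons big_nil addr0.
- by rewrite /= /e br_e // /basis_bracket /= d34 /combine big_cons big_nil addr0.
Qed.

Theorem mainTheorem1 (R : realType) :
  [/\ forall g : listed R, admits_LSSA (listed_Lie g),
      [/\ forall g : listed R, g <> D10_0_1 R -> g <> D10_0_2 R ->
            admits_Novikov (listed_Lie g),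
          ~ admits_Novikov (listed_Lie (D10_0_1 R)) &
          ~ admits_Novikov (listed_Lie (D10_0_2 R))] &
      forall g : listed R, admits_BN (listed_Lie g)].
Proof.
split.
- move=> g; case data: (line_data g) => [d|]; last by case: (semidirect_listed data).
  have [|[mu [[lmu _] cmu]] _] := @line_listed R g; first by rewrite data.
  by exists mu.
- split.
  + move=> g not1 not2; case data: (line_data g) => [d|].
      by have [|novg _] := @line_listed R g; first by rewrite data.
    exact: semidirect_listed_novikov.
  + apply: (D10_0_no_novikov (s := 1)) => //=; first exact: oner_neq0.
    by rewrite mul1r.
  + apply: (D10_0_no_novikov (s := -1)) => //=.
      by rewrite oppr_eq0 oner_neq0.
    by rewrite mulN1r opprK.
- move=> g; case data: (line_data g) => [d|]; last by case: (semidirect_listed data).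
  by have [|_ BNg] := @line_listed R g; first by rewrite data.
Qed.
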